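(* Let $(P,\rhd,\lhd)$ be a Zinbiel-dendriform algebra, $(Q=\bigoplus_{i\in\mathbb Z}Q_i,\circ,\varpi)$ a quadratic $\mathbb Z$-graded Leibniz algebra, and let $P\otimes Q$ carry the $\mathbb Z$-graded pre-Lie product $$(a\otimes x)\cdot(b\otimes y)=(a\rhd b)\otimes (x\circ y)-(b\lhd a)\otimes (y\circ x).$$ Let $r=\sum_iu_i\otimes v_i\in P\otimes P$ be a solution of the ZD-YBE in $(P,\rhd,\lhd)$ with $r+\tau(r)$ invariant in $P\otimes P$. Define $\beta_{\rhd,r},\beta_{\lhd,r}:P\to P\otimes P$ by $$\beta_{\lhd,r}(a)=(I\otimes L_\ominus(a)-L_\ast(a)\otimes I)r,\qquad \beta_{\rhd,r}(a)=(L_\rhd(a)\otimes I-I\otimes(L_\ast+R_\ast)(a))r,$$ and $\delta:P\otimes Q\to(P\otimes Q)\hat\otimes(P\otimes Q)$ by $$\delta(a\otimes x)=\beta_{\rhd,r}(a)\bullet\vartheta_\varpi(x)-\tau\beta_{\lhd,r}(a)\bullet\hat\tau\vartheta_\varpi(x).$$ Then $(P\otimes Q,\cdot,\delta)$ is a completed pre-Lie bialgebra. Moreover, it is precisely the completed quasi-triangular pre-Lie bialgebra $(P\otimes Q,\cdot,\delta_{\hat r})$, that is, $\delta=\delta_{\hat r}$, where $$\delta_{\hat r}(X)=-\big(L_\cdot(X)\hat\otimes I+I\hat\otimes(L_\cdot(X)-R_\cdot(X))\big)\hat r\quad(X\in P\otimes Q),\qquad\hat r=\sum_i\sum_{j\in\Omega}(u_i\otimes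 e_j)\otimes(v_i\otimes f_j),$$ $\{e_j\}_{j\in\Omega}$ being a homogeneous basis of $Q$ and $\{f_j\}_{j\in\Omega}$ its homogeneous dual basis with respect to $\varpi$. In other words, the two constructions $r\mapsto(P,\rhd,\lhd,\beta_{\rhd,r},\beta_{\lhd,r})\mapsto(P\otimes Q,\cdot,\delta)$ and $r\mapsto\hat r\mapsto(P\otimes Q,\cdot,\delta_{\hat r})$ give the same completed pre-Lie bialgebra (the corresponding square commutes).
   Context: All vector spaces are over a field $\mathbb K$; $\tau$ is the flip, $I$ the identity. Algebras are finite-dimensional except $\mathbb Z$-graded ones. For a binary operation $\ast$, $L_\ast(a)b=a\ast b$, $R_\ast(a)b=b\ast a$. Completed tensor products: for $\mathbb Z$-graded $U=\bigoplus U_i$, $V=\bigoplus V_j$, $U\hat\otimes V:=\prod_{i,j}U_i\otimes V_j$ (similarly for three factors); linear maps and the flip ($\hat\tau$) are extended termwise to formal sums. $P$ is in degree $0$, $P\otimes Q=\bigoplus_iP\otimes Q_i$. $(a_1\otimes a_2)\bullet(x_1\otimes x_2)=(a_1\otimes x_1)\otimes(a_2\otimes x_2)$, extended linearly to formal sums. Zinbiel-dendriform algebra: bilinear $\rhd,\lhd$ such that, with $x\ast y=x\rhd y+x\lhd y$: $x\rhd(y\rhd z)=(x\ast y+y\ast x)\rhd z$ and $x\rhd(z\lhd y)=z\lhd(x\ast y)=(x\rhd z)\lhd y+(z\lhd x)\lhd y$. Put $x\ominus y=x\rhd y+y\lhd x$, so $L_\ominus=L_\rhd+R_\lhd$. ZD-YBE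 for $r=\sum_iu_i\otimes v_i$: $\sum_{i,j}\big(u_i\otimes(v_i\ominus u_j)\otimes v_j-u_i\otimes u_j\otimes(v_i\ast v_j)+(u_i\lhd u_j)\otimes v_j\otimes v_i\big)=0$. An element $s\in P\otimes P$ is invariant if for all $m\in P$: $(I\otimes L_\ominus(m)-L_\ast(m)\otimes I)s=0$ and $(L_\rhd(m)\otimes I-I\otimes(L_\ast+R_\ast)(m))s=0$. Quadratic $\mathbb Z$-graded Leibniz algebra $(Q=\bigoplus Q_i,\circ,\varpi)$: each $Q_i$ is finite-dimensional, $Q_i\circ Q_j\subseteq Q_{i+j}$, $x\circ(y\circ z)=(x\circ y)\circ z+y\circ(x\circ z)$, and $\varpi$ is a non-degenerate skew-symmetric bilinear form that is invariant ($\varpi(x\circ y,z)=\varpi(x,y\circ z+z\circ y)$) and graded (there is $m\in\mathbb Z$ with $\varpi(Q_i,Q_j)=0$ whenever $i+j+m\ne0$). $\vartheta_\varpi:Q\to Q\hat\otimes Q$ is the linear map determined by $\hat\varpi(\vartheta_\varpi(b_1),b_2\otimes b_3)=-\varpi(b_1,b_2\circ b_3)$, where $\hat\varpi(\sum x_{1,i,\alpha}\otimes x_{2,j,\alpha},y_1\otimes y_2)=\sum\varpi(x_{1,i,\alpha},y_1)\varpi(x_{2,j,\alpha},y_2)$. Pre-Lie algebra $(L,\cdot)$: $(x\cdot y)\cdot z-x\cdot(y\cdot z)=(y\cdot x)\cdot z-y\cdot(x\cdot z)$; $[x,y]=x\cdot y-y\cdot x$. Completed pre-Lie coalgebra $(L,\delta)$: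 $L=\bigoplus L_i$, $\delta:L\to L\hat\otimes L$ linear with $(I\hat\otimes\delta)\delta-(\hat\tau\hat\otimes I)(I\hat\otimes\delta)\delta=(\delta\hat\otimes I)\delta-(\hat\tau\hat\otimes I)(\delta\hat\otimes I)\delta$. Completed pre-Lie bialgebra $(L,\cdot,\delta)$: $(L,\cdot)$ is a pre-Lie algebra, $(L,\delta)$ is a completed pre-Lie coalgebra, and for all $a,b\in L$: $(\delta-\hat\tau\delta)(a\cdot b)-(L_\cdot(a)\hat\otimes I)(\delta-\hat\tau\delta)(b)-(I\hat\otimes L_\cdot(a))(\delta-\hat\tau\delta)(b)-(I\hat\otimes R_\cdot(b))\delta(a)+(R_\cdot(b)\hat\otimes I)\hat\tau\delta(a)=0$; $\delta(a\cdot b-b\cdot a)-(I\hat\otimes(R_\cdot(b)-L_\cdot(b)))\delta(a)-(I\hat\otimes(L_\cdot(a)-R_\cdot(a)))\delta(b)-(L_\cdot(a)\hat\otimes I)\delta(b)+(L_\cdot(b)\hat\otimes I)\delta(a)=0$. A completed pre-Lie bialgebra of the form $(L,\cdot,\delta_{\hat r})$, $\hat r=\sum a_i\otimes b_i\in L\hat\otimes L$, with $\delta_{\hat r}(x)=-\big(L_\cdot(x)\hat\otimes I+I\hat\otimes(L_\cdot(x)-R_\cdot(x))\big)\hat r$, is completed quasi-triangular if $\hat r$ satisfies the $S$-equation $\sum_{i,j}\big((a_i\cdot a_j)\otimes b_i\otimes b_j-a_i\otimes(b_i\cdot a_j)\otimes b_j-a_i\otimes a_j\otimes[b_i,b_j]\big)=0$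 and $\hat s=\hat r-\hat\tau(\hat r)$ satisfies $\big(L_\cdot(x)\hat\otimes I+I\hat\otimes(L_\cdot(x)-R_\cdot(x))\big)\hat s=0$ for all $x\in L$. *)

(* Defs.v *)
From HB Require Import structures.
From mathcomp Require Import all_boot all_order all_algebra.
From mathcomp Require Import finmap.
From mathcomp Require Import boolp classical_sets functions cardinality fsbigop.

Set Implicit Arguments.
Unset Strict Implicit.
Unset Printing Implicit Defensive.

Import GRing.Theory.
Local Open Scope classical_set_scope.
Local Open Scope ring_scope.

Reserved Notation "u \ot v" (at level 40, left associativity).

Definition bilin (K : fieldType) (U V W : lmodType K) (h : U -> V -> W) : Prop :=
  (forall v, linear (h^~ v)) /\ (forall u, linear (h u)).

(* The tensor product U (x) V of vector spaces of arbitrary dimension: finite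
   formal sums of pairs, two of them being identified when every bilinear map
   takes the same value on both. *)
Section TensorType.
Variables (K : fieldType) (U V : lmodType K).

Definition bsum (W : lmodType K) (h : U -> V -> W) (s : seq (U * V)) : W :=
  \sum_(p <- s) h p.1 p.2.

Definition teq (s t : seq (U * V)) : bool :=
  `[< forall (W : lmodType K) (h : U -> V -> W), bilin h -> bsum h s = bsum h t >].

Lemma teq_refl : reflexive teq.
Proof. by move=> s; apply/asboolP. Qed.

Lemma teq_sym : symmetric teq.
Proof. by move=> s t; apply/asboolP/asboolP => H W h hh; rewrite H. Qed.

Lemma teq_trans : transitive teq.
Proof.
move=> t s w /asboolP H1 /asboolP H2; apply/asboolP => W h hh.
by rewrite H1 // H2.
Qed.

Canonical teq_equiv := EquivRel teq teq_refl teq_sym teq_trans.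

Definition tensor := {eq_quot teq}%qT.

HB.instance Definition _ := Choice.on tensor.

Definition tclass (s : seq (U * V)) : tensor := (\pi_tensor s)%qT.

Lemma tclassP s t :
  (forall (W : lmodType K) (h : U -> V -> W), bilin h -> bsum h s = bsum h t) ->
  tclass s = tclass t.
Proof. by move=> H; apply/eqmodP/asboolP. Qed.

Lemma bsum_repr (W : lmodType K) (h : U -> V -> W) s :
  bilin h -> bsum h (repr (tclass s)) = bsum h s.
Proof.
move=> hh; have /eqmodP/asboolP H : (repr (tclass s) = s %[mod tensor])%qT.
  by rewrite reprK.
exact: H.
Qed.

Lemma tclassK (t : tensor) : tclass (repr t) = t.
Proof. exact: reprK. Qed.

Definition tscale_seq (c : K) (s : seq (U * V)) := [seq (c *: p.1, p.2) | p <- s].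

Lemma bsum_cat (W : lmodType K) (h : U -> V -> W) s t :
  bsum h (s ++ t) = bsum h s + bsum h t.
Proof. by rewrite /bsum big_cat. Qed.

Lemma bilinZl (W : lmodType K) (h : U -> V -> W) c u v :
  bilin h -> h (c *: u) v = c *: h u v.
Proof.
move=> [h1 _]; have := h1 v c u 0; rewrite !addr0 => ->.
suff -> : h 0 v = 0 by rewrite addr0.
by have := h1 v (-1) 0 0; rewrite scaler0 addr0 scaleN1r addNr.
Qed.

Lemma bsum_scale (W : lmodType K) (h : U -> V -> W) c s :
  bilin h -> bsum h (tscale_seq c s) = c *: bsum h s.
Proof.
move=> hh; rewrite /bsum /tscale_seq big_map scaler_sumr.
by apply: eq_bigr => p _ /=; rewrite bilinZl.
Qed.

Definition tzero : tensor := tclass [::].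
Definition tadd (x y : tensor) : tensor := tclass (repr x ++ repr y).
Definition tscale (c : K) (x : tensor) : tensor := tclass (tscale_seq c (repr x)).
Definition topp (x : tensor) : tensor := tscale (-1) x.

Let bE := (bsum_cat, bsum_repr, bsum_scale).

Lemma taddA : associative tadd.
Proof. by move=> x y z; apply: tclassP => W h hh; rewrite !(bE, addrA). Qed.
Lemma taddC : commutative tadd.
Proof. by move=> x y; apply: tclassP => W h hh; rewrite !bE addrC. Qed.
Lemma tadd0 : left_id tzero tadd.
Proof.
move=> x; rewrite -[RHS]tclassK; apply: tclassP => W h hh.
by rewrite !bE // /bsum big_nil add0r.
Qed.
Lemma taddN : left_inverse tzero topp tadd.
Proof.
move=> x; apply: tclassP => W h hh.
by rewrite !bE // scaleN1r addNr /bsum big_nil.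
Qed.
HB.instance Definition _ := GRing.isZmodule.Build tensor taddA taddC tadd0 taddN.

Lemma tscaleA a b x : tscale a (tscale b x) = tscale (a * b) x.
Proof. by apply: tclassP => W h hh; rewrite !bE // scalerA. Qed.
Lemma tscale1 : left_id 1 tscale.
Proof.
move=> x; rewrite -[RHS]tclassK; apply: tclassP => W h hh.
by rewrite !bE // scale1r.
Qed.
Lemma tscaleDr : right_distributive tscale +%R.
Proof. by move=> c x y; apply: tclassP => W h hh; rewrite !bE // scalerDr. Qed.
Lemma tscaleDl x : {morph tscale^~ x : a b / a + b}.
Proof. by move=> a b; apply: tclassP => W h hh; rewrite !bE // scalerDl. Qed.
HB.instance Definition _ :=
  GRing.Zmodule_isLmodule.Build K tensor tscaleA tscale1 tscaleDr tscaleDl.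

Definition ot (u : U) (v : V) : tensor := tclass [:: (u, v)].

Definition tlift (W : lmodType K) (h : U -> V -> W) (t : tensor) : W :=
  bsum h (repr t).

End TensorType.

Notation "u \ot v" := (ot u v) : ring_scope.

Section TensorTheory.
Variables (K : fieldType) (U V : lmodType K).

Lemma bilin_ot : bilin (@ot K U V).
Proof.
split=> [v c x y | u c x y]; apply: tclassP => W h hh;
  rewrite bsum_cat !bsum_repr // bsum_scale // !bsum_repr // /bsum !big_seq1 /=.
- exact: hh.1.
- exact: hh.2.
Qed.

Lemma ot0r (u : U) : u \ot 0 = 0 :> tensor U V.
Proof.
have := bilin_ot.2 u (-1) 0 0.
by rewrite scaler0 addr0 scaleN1r addNr.
Qed.

Lemma tlift_ot (W : lmodType K) (h : U -> V -> W) u v :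
  bilin h -> tlift h (u \ot v) = h u v.
Proof. by move=> hh; rewrite /tlift bsum_repr // /bsum big_seq1. Qed.

Lemma tlift_linear (W : lmodType K) (h : U -> V -> W) :
  bilin h -> linear (tlift h).
Proof.
move=> hh c x y; rewrite /tlift bsum_repr // bsum_cat bsum_repr //.
by rewrite bsum_scale.
Qed.

Lemma tensor_sum (t : tensor U V) : exists s : seq (U * V),
  t = \sum_(p <- s) p.1 \ot p.2.
Proof.
exists (repr t); rewrite -[LHS]tclassK; elim: (repr t) => [|p s IHs].
  by rewrite big_nil.
rewrite big_cons -IHs; apply: tclassP => W h hh.
by rewrite bsum_cat !bsum_repr // -cat1s bsum_cat; case: p.
Qed.

Lemma tensor_ext (W : lmodType K) (f g : {linear tensor U V -> W}) :
  (forall u v, f (u \ot v) = g (u \ot v)) -> f =1 g.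
Proof.
move=> fg t; have [s ->] := tensor_sum t.
by rewrite !linear_sum; apply: eq_bigr => p _; apply: fg.
Qed.

End TensorTheory.

Definition tmap (K : fieldType) (U V U' V' : lmodType K)
    (f : U -> U') (g : V -> V') : tensor U V -> tensor U' V' :=
  tlift (fun x y => f x \ot g y).

Definition tflip (K : fieldType) (U V : lmodType K) : tensor U V -> tensor V U :=
  tlift (fun x y => y \ot x).

Section Product.
Variables (K : fieldType) (J : Type) (W : J -> lmodType K).

Definition cprod := forall k, W k.
HB.instance Definition _ := Choice.copy cprod (forall k, W k).

Implicit Types x y : cprod.
Definition cprod_zero : cprod := fun=> 0.
Definition cprod_add x y : cprod := fun k => x k + y k.
Definition cprod_opp x : cprod := fun k => - x k.
Definition cprod_scale (c : K) x : cprod := fun k => c *: x k.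

Lemma cprod_addA : associative cprod_add.
Proof. by move=> x y z; apply: functional_extensionality_dep => k; apply: addrA. Qed.
Lemma cprod_addC : commutative cprod_add.
Proof. by move=> x y; apply: functional_extensionality_dep => k; apply: addrC. Qed.
Lemma cprod_add0 : left_id cprod_zero cprod_add.
Proof. by move=> x; apply: functional_extensionality_dep => k; apply: add0r. Qed.
Lemma cprod_addN : left_inverse cprod_zero cprod_opp cprod_add.
Proof. by move=> x; apply: functional_extensionality_dep => k; apply: addNr. Qed.
HB.instance Definition _ :=
  GRing.isZmodule.Build cprod cprod_addA cprod_addC cprod_add0 cprod_addN.

Lemma cprod_scaleA a b x :
  cprod_scale a (cprod_scale b x) = cprod_scale (a * b) x.
Proof. by apply: functional_extensionality_dep => k; apply: scalerA. Qed.
Lemma cprod_scale1 : left_id 1 cprod_scale.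
Proof. by move=> x; apply: functional_extensionality_dep => k; apply: scale1r. Qed.
Lemma cprod_scaleDr : right_distributive cprod_scale +%R.
Proof. by move=> c x y; apply: functional_extensionality_dep => k; apply: scalerDr. Qed.
Lemma cprod_scaleDl x : {morph cprod_scale^~ x : a b / a + b}.
Proof. by move=> a b; apply: functional_extensionality_dep => k; apply: scalerDl. Qed.
HB.instance Definition _ := GRing.Zmodule_isLmodule.Build K cprod
  cprod_scaleA cprod_scale1 cprod_scaleDr cprod_scaleDl.

(* The sum of a family of formal sums is computed in each component; it is
   meaningful when the family is summable. *)
Definition summable (I : choiceType) (F : I -> cprod) : Prop :=
  forall k, finite_set [set i | F i k != 0].

Definition fsum (I : choiceType) (F : I -> cprod) : cprod :=
  fun k => \sum_(i \in [set: I]) F i k.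

End Product.

Section DirectSum.
Variables (K : fieldType) (V : int -> lmodType K).

Definition fin_supp : {pred cprod V} :=
  fun x => `[< finite_set [set i | x i != 0] >].

Lemma fin_supp_submod : submod_closed fin_supp.
Proof.
split=> [|c x y /asboolP fx /asboolP fy]; apply/asboolP.
  by apply: (sub_finite_set _ (finite_set0 _)) => i /=; rewrite eqxx.
have fxy : finite_set ([set i | x i != 0] `|` [set i | y i != 0]).
  by rewrite finite_setU.
apply: sub_finite_set fxy => i /= ni.
have [x0|] := eqVneq (x i) 0; last by left.
right; apply: contraNneq ni => y0.
by rewrite -[X in X == 0]/(c *: x i + y i) x0 y0 scaler0 addr0.
Qed.
HB.instance Definition _ := GRing.isSubmodClosed.Build K (cprod V) fin_supp
  fin_supp_submod.

Record dsum := DSum { dsum_val : cprod V; _ : dsum_val \in fin_supp }.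
HB.instance Definition _ := [isSub for dsum_val].
HB.instance Definition _ := [Choice of dsum by <:].
HB.instance Definition _ := [SubChoice_isSubLmodule of dsum by <:].

Definition dcomp (x : dsum) (i : int) : V i := dsum_val x i.
Coercion dcomp : dsum >-> Funclass.

Lemma dinj_subproof i (x : V i) :
  (dfwith (fun j => 0 : V j) x : cprod V) \in fin_supp.
Proof.
apply/asboolP; apply: (sub_finite_set _ (finite_set1 i)) => j /=.
by apply: contraNeq => ji; rewrite dfwith_out // eq_sym.
Qed.
Definition dinj i (x : V i) : dsum := DSum (dinj_subproof x).

Lemma dinj_linear i : linear (@dinj i).
Proof.
move=> c y z; apply: val_inj; apply: functional_extensionality_dep => j /=.
rewrite -[RHS]/(c *: dfwith _ y j + dfwith _ z j).
have [<-|ij] := eqVneq i j; first by rewrite !dfwith_in.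
by rewrite !dfwith_out // scaler0 addr0.
Qed.

Lemma dinj0 i : dinj (0 : V i) = 0.
Proof.
by have := @dinj_linear i (-1) 0 0; rewrite scaler0 addr0 scaleN1r addNr.
Qed.

Lemma dsum_fset (x : dsum) : exists A : {fset int}%fset,
  (forall i, i \notin A -> x i = 0) /\ x = \sum_(i <- A) dinj (x i).
Proof.
have fx : finite_set [set i | x i != 0] by case: (x) => y /= /asboolP.
exists (fset_set [set i | x i != 0]); have xA i :
    i \notin fset_set [set i | x i != 0] -> x i = 0.
  by rewrite in_fset_set // notin_setE /= => /negP /negPn /eqP.
split=> //; move: (fset_set _) xA => A xA.
have sumE j (s : seq int) : uniq s ->
    dsum_val (\sum_(i <- s) dinj (x i)) j = if j \in s then x j else 0.
  elim: s => [|i s IHs] /=; first by rewrite big_nil.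
  case/andP=> nis us; rewrite big_cons inE.
  rewrite -[LHS]/(dfwith _ (x i) j + dsum_val (\sum_(i <- s) dinj (x i)) j) IHs //.
  have [->|ij] := eqVneq j i; first by rewrite dfwith_in (negbTE nis) addr0.
  by rewrite dfwith_out 1?eq_sym // add0r.
apply: val_inj; apply: functional_extensionality_dep => j /=.
by rewrite sumE ?fset_uniq //; case: ifPn => // /xA.
Qed.

Definition in_deg (i : int) (x : dsum) : Prop := forall j, j != i -> x j = 0.

Definition dlift (W : lmodType K) (h : forall i, V i -> W) (x : dsum) : W :=
  \sum_(i \in [set: int]) h i (x i).

Definition graded_mul (mul : dsum -> dsum -> dsum) : Prop :=
  forall i j x y, in_deg i x -> in_deg j y -> in_deg (i + j) (mul x y).

Definition is_basis (I : choiceType) (e : I -> dsum) : Prop :=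
  (forall c : I -> K, finite_set [set j | c j != 0] ->
     \sum_(j \in [set: I]) c j *: e j = 0 -> forall j, c j = 0) /\
  (forall x, exists c : I -> K, finite_set [set j | c j != 0] /\
     x = \sum_(j \in [set: I]) c j *: e j).

Definition homogeneous_basis (I : choiceType) (e : I -> dsum) : Prop :=
  is_basis e /\ forall j, exists i, in_deg i (e j).

(* As varpi is skew-symmetric, the other normalisation varpi (e j) (f k) = delta_jk
   would replace f by - f, hence rhat by - rhat and coboundary rhat by its opposite. *)
Definition homogeneous_dual_basis (varpi : dsum -> dsum -> K) (I : choiceType)
    (e f : I -> dsum) : Prop :=
  homogeneous_basis f /\ forall j k, varpi (f j) (e k) = (j == k)%:R.

End DirectSum.

Section Completed.
Variables (K : fieldType) (V : int -> lmodType K).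
Local Notation L := (dsum V).

Definition ctens2 : lmodType K :=
  cprod (fun k : int * int => tensor (V k.1) (V k.2)).
Definition ctens3 : lmodType K :=
  cprod (fun k : int * int * int => tensor (V k.1.1) (tensor (V k.1.2) (V k.2))).

Definition cot (x y : L) : ctens2 := fun k => x k.1 \ot y k.2.
Definition cot12 (x : L) (T : ctens2) : ctens3 :=
  fun k => x k.1.1 \ot T (k.1.2, k.2).
Definition cot21 (T : ctens2) (x : L) : ctens3 :=
  fun k => tlift (fun a b => a \ot (b \ot x k.2)) (T (k.1.1, k.1.2)).
Definition cot3 (x y z : L) : ctens3 := cot12 x (cot y z).

Definition cflip (T : ctens2) : ctens2 := fun k => tflip (T (k.2, k.1)).
Definition cflip12 (T : ctens3) : ctens3 :=
  fun k => tlift (fun u => tlift (fun v w => v \ot (u \ot w)))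
             (T ((k.1.2, k.1.1), k.2)).

(* The termwise extension of a bilinear map to formal sums; only used at bilinear
   maps built from locally finite linear maps, for which the sums over the
   bidegrees are finite in each component. *)
Definition termwise (J : Type) (W : J -> lmodType K) (h : L -> L -> cprod W)
    (T : ctens2) : cprod W :=
  fsum (fun k : int * int => tlift (fun x y => h (dinj x) (dinj y)) (T k)).

Definition loc_finite (J : Type) (W : J -> lmodType K) (f : L -> cprod W) : Prop :=
  forall k, finite_set [set i | exists x : V i, f (dinj x) k != 0].

Definition cmap (f g : L -> L) (T : ctens2) : ctens2 :=
  termwise (fun x y => cot (f x) (g y)) T.
Definition id_cdelta (delta : L -> ctens2) (T : ctens2) : ctens3 :=
  termwise (fun x y => cot12 x (delta y)) T.
Definition cdelta_id (delta : L -> ctens2) (T : ctens2) : ctens3 :=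
  termwise (fun x y => cot21 (delta x) y) T.

Definition hat_form (varpi : L -> L -> K) (T : ctens2) (y1 y2 : L) : K :=
  \sum_(k \in [set: int * int])
    tlift (fun x1 x2 => varpi (dinj x1) y1 * varpi (dinj x2) y2 : K^o) (T k).

Record preLie_algebra (mul : L -> L -> L) : Prop := {
  preLie_bilin : bilin mul;
  preLie_identity : forall x y z,
    mul (mul x y) z - mul x (mul y z) = mul (mul y x) z - mul y (mul x z) }.

Record completed_preLie_coalgebra (delta : L -> ctens2) : Prop := {
  coalgebra_linear : linear delta;
  coalgebra_loc_finite : loc_finite delta;
  coalgebra_identity : forall x,
    id_cdelta delta (delta x) - cflip12 (id_cdelta delta (delta x)) =
    cdelta_id delta (delta x) - cflip12 (cdelta_id delta (delta x)) }.

Record completed_preLie_bialgebra (mul : L -> L -> L) (delta : L -> ctens2) :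
    Prop := {
  bialgebra_algebra : preLie_algebra mul;
  bialgebra_coalgebra : completed_preLie_coalgebra delta;
  bialgebra_left_loc_finite : forall a, loc_finite (fun x => dsum_val (mul a x));
  bialgebra_right_loc_finite : forall a, loc_finite (fun x => dsum_val (mul x a));
  bialgebra_compat1 : forall a b,
    (delta (mul a b) - cflip (delta (mul a b)))
    - cmap (mul a) id (delta b - cflip (delta b))
    - cmap id (mul a) (delta b - cflip (delta b))
    - cmap id (mul^~ b) (delta a)
    + cmap (mul^~ b) id (cflip (delta a)) = 0;
  bialgebra_compat2 : forall a b,
    delta (mul a b - mul b a)
    - cmap id (fun x => mul x b - mul b x) (delta a)
    - cmap id (fun x => mul a x - mul x a) (delta b)
    - cmap (mul a) id (delta b)
    + cmap (mul b) id (delta a) = 0 }.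

Definition preLie_act (mul : L -> L -> L) (x : L) (T : ctens2) : ctens2 :=
  cmap (mul x) id T + cmap id (fun y => mul x y - mul y x) T.

Definition coboundary (mul : L -> L -> L) (r : ctens2) (x : L) : ctens2 :=
  - preLie_act mul x r.

Definition S_term (mul : L -> L -> L) (r : ctens2)
    (k : (int * int) * (int * int)) : ctens3 :=
  tlift (fun a b => tlift (fun a' b' =>
      let A := dinj a in let B := dinj b in
      let A' := dinj a' in let B' := dinj b' in
      cot3 (mul A A') B B' - cot3 A (mul B A') B'
      - cot3 A A' (mul B B' - mul B' B)) (r k.2)) (r k.1).

Definition S_equation (mul : L -> L -> L) (r : ctens2) : Prop :=
  summable (S_term mul r) /\ fsum (S_term mul r) = 0.

Definition completed_quasi_triangular (mul : L -> L -> L) (delta : L -> ctens2)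
    (r : ctens2) : Prop :=
  [/\ completed_preLie_bialgebra mul delta,
      delta = coboundary mul r,
      S_equation mul r &
      forall x, preLie_act mul x (r - cflip r) = 0].

Record quadratic_graded_Leibniz (circ : L -> L -> L) (varpi : L -> L -> K) :
    Prop := {
  Leibniz_bilin : bilin circ;
  Leibniz_graded : graded_mul circ;
  Leibniz_identity : forall x y z,
    circ x (circ y z) = circ (circ x y) z + circ y (circ x z);
  form_bilin : bilin (varpi : L -> L -> K^o);
  form_nondegenerate : forall x, (forall y, varpi x y = 0) -> x = 0;
  form_skew : forall x y, varpi x y = - varpi y x;
  form_invariant : forall x y z,
    varpi (circ x y) z = varpi x (circ y z + circ z y);
  form_graded : exists m : int, forall i j x y,
    in_deg i x -> in_deg j y -> i + j + m != 0 -> varpi x y = 0 }.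

Definition is_vartheta (circ : L -> L -> L) (varpi : L -> L -> K)
    (theta : L -> ctens2) : Prop :=
  linear theta /\ forall b1 b2 b3,
    hat_form varpi (theta b1) b2 b3 = - varpi b1 (circ b2 b3).

Definition vartheta (circ : L -> L -> L) (varpi : L -> L -> K) : L -> ctens2 :=
  xget (fun=> 0) [set theta | is_vartheta circ varpi theta].

End Completed.

Section ZinbielDendriform.
Variables (K : fieldType) (P : lmodType K) (rhd lhd : P -> P -> P).

Definition ast x y := rhd x y + lhd x y.
Definition ominus x y := rhd x y + lhd y x.

Record Zinbiel_dendriform : Prop := {
  rhd_bilin : bilin rhd;
  lhd_bilin : bilin lhd;
  ZD_rhd_rhd : forall x y z, rhd x (rhd y z) = rhd (ast x y + ast y x) z;
  ZD_rhd_lhd : forall x y z, rhd x (lhd z y) = lhd z (ast x y);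
  ZD_lhd_ast : forall x y z,
    lhd z (ast x y) = lhd (rhd x z) y + lhd (lhd z x) y }.

(* The equation for the tensor r = \sum_i u i \ot v i. *)
Definition ZD_YBE (n : nat) (u v : 'I_n -> P) : Prop :=
  \sum_i \sum_j (u i \ot (ominus (v i) (u j) \ot v j)
                 - u i \ot (u j \ot ast (v i) (v j))
                 + lhd (u i) (u j) \ot (v j \ot v i)) = 0.

Definition beta_lhd (r : tensor P P) (a : P) : tensor P P :=
  tmap id (ominus a) r - tmap (ast a) id r.
Definition beta_rhd (r : tensor P P) (a : P) : tensor P P :=
  tmap (rhd a) id r - tmap id (fun x => ast a x + ast x a) r.

Definition invariant_tensor (s : tensor P P) : Prop :=
  forall m, beta_lhd s m = 0 /\ beta_rhd s m = 0.

End ZinbielDendriform.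

Section Affinization.
Variables (K : fieldType) (P : lmodType K) (Q : int -> lmodType K).

Definition PQ_comp (i : int) : lmodType K := tensor P (Q i).
Local Notation PQ := (dsum PQ_comp).

Lemma PQ_pure_subproof (a : P) (x : dsum Q) :
  ((fun i => a \ot x i) : cprod PQ_comp) \in @fin_supp K PQ_comp.
Proof.
case: x => x /[dup] /asboolP fx xP; apply/asboolP.
apply: sub_finite_set fx => i /=; apply: contraNneq => /= x0.
by rewrite /dcomp /= x0 ot0r.
Qed.
Definition PQ_pure (a : P) (x : dsum Q) : PQ := DSum (PQ_pure_subproof a x).

(* The linear map on P (x) Q determined by its values h a x at a (x) x. *)
Definition PQ_lift (W : lmodType K) (h : P -> dsum Q -> W) : PQ -> W :=
  dlift (fun i => tlift (fun a (x : Q i) => h a (dinj x))).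

Lemma PQ_lift_pure (W : lmodType K) (h : P -> dsum Q -> W) a x :
  bilin h -> PQ_lift h (PQ_pure a x) = h a x.
Proof.
move=> hh; pose g := GRing.isLinear.Build K _ _ _ (h a) (hh.2 a).
pose ha : {linear dsum Q -> W} := HB.pack (h a) g.
have hE y : h a y = ha y by [].
have [A [xA xE]] := dsum_fset x.
rewrite [in RHS]xE hE linear_sum /PQ_lift /dlift.
have tE i : tlift (fun b (y : Q i) => h b (dinj y)) (a \ot x i) = ha (dinj (x i)).
  rewrite tlift_ot //; split=> [y|b] c y1 y2; first exact: hh.1.
  by rewrite dinj_linear; apply: hh.2.
rewrite (eq_fsbigr (fun i => ha (dinj (x i)))) => [|i _]; last exact: tE.
by apply: fsbigTE => i /xA ->; rewrite dinj0 linear0.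
Qed.

Definition PQ_bullet (s : tensor P P) (T : ctens2 Q) : ctens2 PQ_comp :=
  fun k => tlift (fun a1 a2 => tlift (fun x1 x2 =>
             (a1 \ot x1) \ot (a2 \ot x2)) (T k)) s.

Variables (rhd lhd : P -> P -> P) (circ : dsum Q -> dsum Q -> dsum Q).

Definition PQ_mul (X Y : PQ) : PQ :=
  PQ_lift (fun a x => PQ_lift (fun b y =>
    PQ_pure (rhd a b) (circ x y) - PQ_pure (lhd b a) (circ y x)) Y) X.

Variable varpi : dsum Q -> dsum Q -> K.

Definition PQ_delta (r : tensor P P) : PQ -> ctens2 PQ_comp :=
  PQ_lift (fun a x =>
    PQ_bullet (beta_rhd rhd lhd r a) (vartheta circ varpi x)
    - PQ_bullet (tflip (beta_lhd rhd lhd r a)) (cflip (vartheta circ varpi x))).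

Definition rhat (n : nat) (u v : 'I_n -> P) (I : choiceType) (e f : I -> dsum Q) :
    ctens2 PQ_comp :=
  \sum_i fsum (fun j : I => cot (PQ_pure (u i) (e j)) (PQ_pure (v i) (f j))).

End Affinization.

(* Main.v *)
Require Import Defs.
From mathcomp Require Import all_boot all_order all_algebra.
From mathcomp Require Import finmap ring.
From mathcomp Require Import boolp classical_sets functions cardinality fsbigop.

(* A linear functional on L = P (x) Q that vanishes on all but finitely many
   homogeneous components can be evaluated on each slot of a completed tensor,
   and these functionals form a "graded dual" that separates formal sums.  By
   duality the completed coproduct of the coboundary of r becomes a product
     (F * H)(x) = - F(x . rho' H) - H([x, rho F])
   on the graded dual, where rho F = (F (x) id) r and rho' H = (id (x) H) r.
   The S-equation and the invariance of r - tau r say exactly that - rho and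
   - rho' are multiplicative, and then the coalgebra and compatibility
   conditions become linear consequences of the pre-Lie identity.

   On P (x) Q it suffices to test against a (x) z |-> xi(a) varpi(z, y), for
   which rhat acts as - r(xi) (x) y and r'(xi) (x) y.  The invariance of varpi
   leaves only two independent scalars among varpi(x o y, z), varpi(y o x, z)
   and varpi(z o x, y), and comparing their coefficients reduces the S-equation
   to two instances of the ZD-YBE, and the equality of the two coproducts to the
   invariance of r + tau r. *)

(** A direct verification is blocked because [rhat] is an infinite formal sum and the iterated
    coproducts live in infinite products, so they have no finite representatives to compute with.
    Two finiteness facts make the passage to functionals work. Since [e j] and [f j] pair
    nontrivially, all terms of [rhat] have the same total degree, so contracting with a functional
    supported in finitely many degrees leaves a genuine element of P (x) Q. And P and the components
    of Q are finite-dimensional, so finitely many functionals detect each component. For - rho,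
    multiplicativity comes from the S-equation and the invariance at the element [rho F]. For - rho'
    the invariance is first added to its own flip: r - tau r being skew, this leaves an identity
    with right multiplications only. On P (x) Q the skewness of varpi exchanges symmetric and skew:
    the two contractions of [rhat] carry opposite signs, so the skew part of [rhat] contracts to the
    sum of the two contractions of r, that is, to r + tau r. *)

Set Implicit Arguments.
Unset Strict Implicit.
Unset Printing Implicit Defensive.

Import GRing.Theory.
Local Open Scope classical_set_scope.
Local Open Scope ring_scope.

(* Subtracting multiples of known equations l = r from the goal a = b until only a
   ring identity is left. *)
Lemma sub_lincomb (K : fieldType) (c l r a b : K) :
  l = r -> a - c * (l - r) = b -> a = b.
Proof. by move=> ->; rewrite subrr mulr0 subr0. Qed.

Local Tactic Notation "lincomb" uconstr(c) constr(h) :=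
  refine (sub_lincomb (c := c) h _).

(** * Quasi-triangularity on the dual side *)

(* ev F x is the value at x of a functional F, GL F x and GR F x are F composed
   with left and right multiplication by x, and star is the product dual to the
   coboundary of the tensor r with r(F, H) = ev H (rho F) = ev F (rho' H). *)
Section DualSystem.
Variables (K : fieldType) (L : lmodType K) (G : Type) (ev : G -> L -> K).
Variables (mul : L -> L -> L) (GL GR : G -> L -> G) (rho rho' : G -> L).
Variable star : G -> G -> G.
Local Notation "x ** y" := (mul x y) (at level 40, left associativity).

Hypothesis evD : forall F, {morph ev F : x y / x + y}.
Hypothesis evN : forall F, {morph ev F : x / - x}.
Hypothesis mul_preLie : forall x y z,
  x ** y ** z - x ** (y ** z) = y ** x ** z - y ** (x ** z).
Hypothesis evGL : forall F x y, ev (GL F x) y = ev F (x ** y).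
Hypothesis evGR : forall F x y, ev (GR F x) y = ev F (y ** x).
Hypothesis rhoE : forall F H, ev F (rho' H) = ev H (rho F).
Hypothesis starE : forall F H x, ev (star F H) x =
  - ev F (x ** rho' H) - (ev H (x ** rho F) - ev H (rho F ** x)).
Hypothesis SE : forall F H T,
  ev F (rho' H ** rho' T) - ev H (rho F ** rho' T)
  - (ev T (rho F ** rho H) - ev T (rho H ** rho F)) = 0.
Hypothesis invE : forall x F H,
  ev F (x ** rho H) - ev F (x ** rho' H) =
  (ev H (x ** rho F) - ev H (rho F ** x))
  - (ev H (x ** rho' F) - ev H (rho' F ** x)).

Lemma ev_preLie F x y z :
  ev F (x ** y ** z) - ev F (x ** (y ** z)) =
  ev F (y ** x ** z) - ev F (y ** (x ** z)).
Proof. by rewrite -!evN -!evD mul_preLie. Qed.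

(** By duality the left side is [star F H] at [rho' T]. The S-equation at (F, T, H) replaces its
    first term by values at [rho F], and the invariance at [rho F] collapses what remains to a
    single product. *)
Lemma rho_star F H T : ev T (rho (star F H)) = - ev T (rho F ** rho H).
Proof.
rewrite -rhoE starE.
lincomb (-1) (SE F T H); lincomb 1 (invE (rho F) T H).
by ring.
Qed.

(** The difference [rho] - [rho'] is the contraction of the skew tensor r - tau r. Adding the
    invariance for (F, H) to that for (H, F) cancels all left multiplications by x. *)
Lemma invE_mulx x F H : ev H (rho F ** x) - ev H (rho' F ** x) =
  ev F (rho' H ** x) - ev F (rho H ** x).
Proof. by lincomb 1 (invE x F H); lincomb 1 (invE x H F); ring. Qed.

Lemma rho'_star F H T : ev T (rho' (star F H)) = - ev T (rho' F ** rho' H).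
Proof.
rewrite rhoE starE.
lincomb (-1) (SE F T H).
lincomb (-1) (invE_mulx (rho' H) T F).
by ring.
Qed.

(** Invariance with a left multiplication by x and a right multiplication by y at once: [invE_mulx]
    is applied to [GL F x], the invariance to [GR H y], and the two are matched by moving
    multiplications between functionals and arguments. *)
Lemma invE_xmul x y F H :
  ev F (x ** (rho H ** y)) - ev F (x ** (rho' H ** y)) =
  (ev H (x ** rho F ** y) - ev H (rho F ** x ** y))
  - (ev H (x ** rho' F ** y) - ev H (rho' F ** x ** y)).
Proof.
have e1 : ev H (rho' (GL F x) ** y) = ev F (x ** rho (GR H y)).
  by rewrite -evGR rhoE evGL.
have e2 : ev H (rho (GL F x) ** y) = ev F (x ** rho' (GR H y)).
  by rewrite -evGR -rhoE evGL.
have := invE_mulx y H (GL F x); rewrite !evGL e1 e2 => inv1.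
have := invE x F (GR H y); rewrite !evGR => inv2.
by lincomb 1 inv1; lincomb 1 inv2; ring.
Qed.

(** Multiplicativity removes the nested stars, so each term is F, H or T on a product of x and two
    contractions. The invariance lemmas exchange [rho H] with [rho' H] under F against [rho F] with
    [rho' F] under H. The three pre-Lie instances under T add up to the Jacobi identity for x,
    [rho F] and [rho H]. *)
Lemma star_preLie F H T x :
  ev (star F (star H T)) x - ev (star H (star F T)) x =
  ev (star (star F H) T) x - ev (star (star H F) T) x.
Proof.
have GLr F1 y H1 H2 : ev F1 (y ** rho' (star H1 H2)) =
    - ev F1 (y ** (rho' H1 ** rho' H2)).
  by rewrite -evGL rho'_star evGL.
have GLr1 F1 y H1 H2 : ev F1 (y ** rho (star H1 H2)) =
    - ev F1 (y ** (rho H1 ** rho H2)).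
  by rewrite -evGL rho_star evGL.
have GRr1 F1 y H1 H2 : ev F1 (rho (star H1 H2) ** y) =
    - ev F1 (rho H1 ** rho H2 ** y).
  by rewrite -evGR rho_star evGR.
rewrite !starE !GLr !GLr1 !GRr1.
lincomb (-1) (ev_preLie F x (rho H) (rho' T)).
lincomb 1 (invE (x ** rho' T) F H).
lincomb (-1) (invE_xmul x (rho' T) F H).
lincomb 1 (ev_preLie H x (rho' F) (rho' T)).
lincomb 1 (ev_preLie T x (rho F) (rho H)).
lincomb 1 (ev_preLie T (rho H) x (rho F)).
lincomb 1 (ev_preLie T (rho F) (rho H) x).
by ring.
Qed.

(** Invariance cancels the left multiplications by x: the commutator of the dual product, which is
    dual to delta - tau delta, involves right multiplications only. *)
Lemma star_sub F H x :
  ev (star F H) x - ev (star H F) x = ev H (rho' F ** x) - ev F (rho H ** x).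
Proof. by rewrite !starE; lincomb 1 (invE x F H); ring. Qed.

(** The first bialgebra compatibility, tested against F and H, with multiplications moved onto the
    functionals. After [star_sub] one instance of the invariance and two of the pre-Lie identity
    suffice. *)
Lemma star_compat1 F H a b :
  (ev (star F H) (a ** b) - ev (star H F) (a ** b))
  - (ev (star (GL F a) H) b - ev (star H (GL F a)) b)
  - (ev (star F (GL H a)) b - ev (star (GL H a) F) b)
  - ev (star F (GR H b)) a + ev (star H (GR F b)) a = 0.
Proof.
rewrite !star_sub !starE !evGL !evGR.
have -> : ev H (rho' (GL F a) ** b) = ev F (a ** rho (GR H b)).
  by rewrite -evGR rhoE evGL.
have -> : ev F (rho (GL H a) ** b) = ev H (a ** rho' (GR F b)).
  by rewrite -evGR -rhoE evGL.
have := invE a F (GR H b); rewrite !evGR => inv.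
lincomb (-1) inv.
lincomb 1 (ev_preLie H a (rho' F) b); lincomb (-1) (ev_preLie F a (rho H) b).
by ring.
Qed.

End DualSystem.

(** * Finite sums and completed tensors *)

Section Additive.
Variables (U V : zmodType) (f : U -> V).
Hypothesis fD : {morph f : x y / x + y}.

Lemma addf0 : f 0 = 0.
Proof. by apply: (addrI (f 0)); rewrite -fD !addr0. Qed.

Lemma addfN : {morph f : x / - x}.
Proof. by move=> x; apply: (addrI (f x)); rewrite -fD !subrr addf0. Qed.

Lemma addfB : {morph f : x y / x - y}.
Proof. by move=> x y; rewrite fD addfN. Qed.

Lemma addf_sum (I : Type) (s : seq I) (F : I -> U) :
  f (\sum_(i <- s) F i) = \sum_(i <- s) f (F i).
Proof. exact: (big_morph f fD addf0). Qed.

End Additive.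

Section FiniteSums.
Variable V : zmodType.

(** A sum over [[set: I]] takes the default value 0 when the support is infinite, so additivity and
    the exchange of sums hold only under this condition. *)
Definition finsup (I : choiceType) (F : I -> V) := finite_set [set i | F i != 0].

Lemma fsbigT_fset (I : choiceType) (A : set I) (F : I -> V) :
  finite_set A -> (forall i, F i != 0 -> A i) ->
  \sum_(i \in [set: I]) F i = \sum_(i <- fset_set A) F i.
Proof.
move=> fA FA; apply: fsbigTE => i; rewrite in_fset_set // notin_setE => nA.
by apply/eqP; apply: contra_notT nA; exact: FA.
Qed.

Lemma sub_finsup (I : choiceType) (A : set I) (F : I -> V) :
  finite_set A -> (forall i, F i != 0 -> A i) -> finsup F.
Proof. by move=> fA FA; apply: sub_finite_set fA => i /= /FA. Qed.

Lemma eq_fsbigT (I : choiceType) (F G : I -> V) : F =1 G ->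
  \sum_(i \in [set: I]) F i = \sum_(i \in [set: I]) G i.
Proof. by move=> FG; apply: eq_fsbigr => i _. Qed.

Lemma fsbigT0 (I : choiceType) (F : I -> V) : (forall i, F i = 0) ->
  \sum_(i \in [set: I]) F i = 0.
Proof. by move=> F0; apply: fsbig1 => i _. Qed.

Lemma fsbigTD (I : choiceType) (F G : I -> V) : finsup F -> finsup G ->
  \sum_(i \in [set: I]) (F i + G i) =
  \sum_(i \in [set: I]) F i + \sum_(i \in [set: I]) G i.
Proof.
move=> fF fG; pose A := [set i | F i != 0] `|` [set i | G i != 0].
have fA : finite_set A by rewrite finite_setU.
rewrite !(@fsbigT_fset _ A) ?big_split // => i.
- by right.
- by left.
- by move=> FG; have [F0|] := eqVneq (F i) 0; [right; move: FG; rewrite F0 add0r|left].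
Qed.

Lemma finsupN (I : choiceType) (F : I -> V) : finsup F -> finsup (fun i => - F i).
Proof. by move=> fF; apply: (sub_finsup fF) => i; rewrite oppr_eq0. Qed.

Lemma finsupD (I : choiceType) (F G : I -> V) :
  finsup F -> finsup G -> finsup (fun i => F i + G i).
Proof.
move=> fF fG; have fU := conj fF fG; rewrite -finite_setU in fU.
apply: (sub_finsup fU) => i; have [->|Fi] := eqVneq (F i) 0; last by left.
by rewrite add0r; right.
Qed.

Lemma fsbigT_single (I : choiceType) (F : I -> V) i0 :
  (forall i, i != i0 -> F i = 0) -> \sum_(i \in [set: I]) F i = F i0.
Proof.
move=> F0; rewrite (@fsbigT_fset _ [set i0]) ?fset_set1 ?big_seq_fset1 //.
by move=> i; apply: contraNP => /eqP/F0 ->.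
Qed.

Lemma fsbigT_pair (I J : choiceType) (F : I * J -> V) : finsup F ->
  \sum_(k \in [set: I * J]) F k =
  \sum_(i \in [set: I]) \sum_(j \in [set: J]) F (i, j).
Proof.
move=> fF; set S := [set k | F k != 0] in fF.
pose A := fst @` S; pose B := snd @` S.
have fA : finite_set A by apply: finite_image.
have fB : finite_set B by apply: finite_image.
have inS i j : F (i, j) != 0 -> A i /\ B j by move=> Fn; split; exists (i, j).
have eB i : \sum_(j \in [set: J]) F (i, j) = \sum_(j \in B) F (i, j).
  by rewrite (@fsbigT_fset _ B) ?fsbig_finite // => j /inS[].
rewrite (eq_fsbigT eB) (@fsbigT_fset _ A) //; last first.
  move=> i; apply: contraNP => nA; apply/eqP/fsbig1 => j _.
  by apply/eqP; apply: contra_notT nA => /inS[].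
rewrite -(fsbig_finite _ _ fA) pair_fsbig // fsbig_finite; last exact: finite_setX.
rewrite (@fsbigT_fset _ (A `*` B)); [|exact: finite_setX|by case=> i j /inS].
by apply: eq_bigr => -[].
Qed.

Lemma exchange_fsbigT (I J : choiceType) (F : I -> J -> V) :
  finsup (fun k : I * J => F k.1 k.2) ->
  \sum_(i \in [set: I]) \sum_(j \in [set: J]) F i j =
  \sum_(j \in [set: J]) \sum_(i \in [set: I]) F i j.
Proof.
move=> fF; rewrite -(fsbigT_pair fF) -(@fsbigT_pair _ _ (fun k => F k.2 k.1)).
  rewrite (@reindex_fsbigT _ _ _ (J * I)%type (I * J)%type (fun k => (k.2, k.1))) //.
  by exists (fun k => (k.2, k.1)) => -[].
apply: (sub_finite_set _ (finite_image (fun k : I * J => (k.2, k.1)) fF)).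
by move=> [j i] /= Fn; exists (i, j).
Qed.

End FiniteSums.

Lemma addf_fsbigT (U V : zmodType) (f : U -> V) (I : choiceType) (F : I -> U) :
  {morph f : x y / x + y} -> finsup F ->
  f (\sum_(i \in [set: I]) F i) = \sum_(i \in [set: I]) f (F i).
Proof.
move=> fD fF; rewrite !(@fsbigT_fset _ _ [set i | F i != 0]) ?addf_sum // => i /=.
by apply: contraNN => /eqP ->; rewrite (addf0 fD) eqxx.
Qed.

Lemma fsbigTN (V : zmodType) (I : choiceType) (F : I -> V) : finsup F ->
  \sum_(i \in [set: I]) - F i = - \sum_(i \in [set: I]) F i.
Proof. by move=> fF; rewrite (addf_fsbigT (@opprD V)). Qed.

Section Lift.
Variables (K : fieldType) (U V : lmodType K).

Lemma tliftE (W : lmodType K) (h : U -> V -> W) t :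
  tlift h t = \sum_(p <- repr t) h p.1 p.2.
Proof. by []. Qed.

Lemma eq_tlift (W : lmodType K) (h h' : U -> V -> W) t :
  (forall u v, h u v = h' u v) -> tlift h t = tlift h' t.
Proof. by move=> hh; rewrite !tliftE; apply: eq_bigr. Qed.

(** [tlift] sums over the chosen representative of t, so this holds for every h, bilinear or not;
    bilinearity of h enters only when t itself is decomposed. *)
Lemma addf_tlift (W W' : lmodType K) (f : W -> W') (h : U -> V -> W) t :
  {morph f : x y / x + y} -> f (tlift h t) = tlift (fun u v => f (h u v)) t.
Proof. by move=> fD; rewrite !tliftE (addf_sum fD). Qed.

Lemma tlift_bilinD (W : lmodType K) (h : U -> V -> W) :
  bilin h -> {morph tlift h : x y / x + y}.
Proof. by move=> /tlift_linear hl x y; have := hl 1 x y; rewrite !scale1r. Qed.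

Lemma tlift_bilinZ (W : lmodType K) (h : U -> V -> W) c x :
  bilin h -> tlift h (c *: x) = c *: tlift h x.
Proof.
move=> hh; have := tlift_linear hh c x 0; rewrite !addr0 => ->.
by rewrite (addf0 (tlift_bilinD hh)) addr0.
Qed.

(** This expands t over the very representative that [tliftE] produces elsewhere, so that such sums
    can be compared term by term. *)
Lemma tensor_span (t : tensor U V) : t = tlift (@ot K U V) t.
Proof.
have [s {1 2}->] := tensor_sum t.
rewrite (addf_sum (tlift_bilinD (bilin_ot U V))).
by apply: eq_bigr => p _; rewrite tlift_ot //; exact: bilin_ot.
Qed.

End Lift.

(** * Functionals on products that see finitely many components *)

Section ComponentSum.
Variables (K : fieldType) (J : choiceType) (W : J -> lmodType K) (M : lmodType K).
Implicit Types (g : forall k, W k -> M) (T : cprod W).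

Definition csum g T : M := \sum_(k \in [set: J]) g k (T k).

(** For the product topology with discrete factors these are the continuous additive maps; depending
    on finitely many components is what lets them pass through infinite formal sums. *)
Definition finform g : Prop :=
  (forall k, {morph g k : x y / x + y}) /\
  finite_set [set k | exists t, g k t != 0].

Lemma csum_finsup g T : finform g -> finsup (fun k => g k (T k)).
Proof. by move=> [_ gF]; apply: (sub_finsup gF) => k; exists (T k). Qed.

Lemma csumD g : finform g -> {morph csum g : T T' / T + T'}.
Proof.
move=> gf T T'; rewrite /csum -fsbigTD; try exact: csum_finsup.
by apply: eq_fsbigT => k; rewrite -gf.1.
Qed.

Lemma csumZ g c T : finform g -> (forall k t, g k (c *: t) = c *: g k t) ->
  csum g (c *: T) = c *: csum g T.
Proof.
move=> gf gZ; rewrite /csum (addf_fsbigT (@scalerDr _ _ c)); last exact: csum_finsup.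
by apply: eq_fsbigT => k; rewrite -gZ.
Qed.

Lemma csum_fsum g (I : choiceType) (F : I -> cprod W) :
  finform g -> summable F ->
  csum g (fsum F) = \sum_(i \in [set: I]) csum g (F i).
Proof.
move=> gf sF; rewrite exchange_fsbigT.
  by apply: eq_fsbigT => k; rewrite (addf_fsbigT (gf.1 k)) //; exact: sF.
pose A := [set k | exists t, g k t != 0].
have fAB : finite_set (\bigcup_(k in A) ((fun i : I => (i, k)) @` [set i | F i k != 0])).
  by apply: bigcup_finite; [exact: gf.2|move=> k _; apply: finite_image; exact: sF].
apply: (sub_finsup fAB) => -[i k] /= gn; exists k; first by exists (F i k).
by exists i => //=; apply: contraNneq gn => ->; rewrite (addf0 (gf.1 k)) eqxx.
Qed.

(** The second hypothesis says that each component of the output receives contributions from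
    finitely many bidegrees, so the sum behind [termwise] is summable. *)
Lemma csum_termwise (V : int -> lmodType K) g (h : dsum V -> dsum V -> cprod W)
    (T : ctens2 V) :
  finform g ->
  (forall c, finite_set [set k : int * int |
     exists x : V k.1, exists y : V k.2, h (dinj x) (dinj y) c != 0]) ->
  csum g (termwise h T) = \sum_(k \in [set: int * int])
    tlift (fun x y => csum g (h (dinj x) (dinj y))) (T k).
Proof.
move=> gf hf; rewrite /termwise csum_fsum //.
  by apply: eq_fsbigT => k; rewrite (addf_tlift _ _ (csumD gf)).
move=> c; apply: sub_finite_set (hf c) => k /=; apply: contraNP => nh.
rewrite (@addf_tlift _ _ _ _ _ (fun x : cprod W => x c)) // tliftE big1 // => p _.
apply/eqP; apply: contra_notT nh => hn; by exists p.1, p.2.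
Qed.

End ComponentSum.

Section Bilin.
Variables (K : fieldType) (U V W : lmodType K) (h : U -> V -> W).
Hypothesis hh : bilin h.

Lemma bilinDl v : {morph h^~ v : x y / x + y}.
Proof. by move=> x y; have := hh.1 v 1 x y; rewrite !scale1r. Qed.
Lemma bilinDr u : {morph h u : x y / x + y}.
Proof. by move=> x y; have := hh.2 u 1 x y; rewrite !scale1r. Qed.
Lemma bilinZr c u v : h u (c *: v) = c *: h u v.
Proof.
by have := hh.2 u c v 0; rewrite !addr0 (addf0 (bilinDr u)) addr0.
Qed.

End Bilin.

Lemma tlift_neq0 (K : fieldType) (U V W : lmodType K) (h : U -> V -> W) t :
  tlift h t != 0 -> exists u v, h u v != 0.
Proof.
apply: contraNP => hn; rewrite tliftE big1 // => p _.
by apply/eqP; apply: contra_notT hn => hp; exists p.1, p.2.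
Qed.

Lemma linfD (K : fieldType) (U V : lmodType K) (f : U -> V) :
  linear f -> {morph f : x y / x + y}.
Proof. by move=> lf x y; have := lf 1 x y; rewrite !scale1r. Qed.

Lemma linfZ (K : fieldType) (U V : lmodType K) (f : U -> V) c x :
  linear f -> f (c *: x) = c *: f x.
Proof.
by move=> lf; have := lf c x 0; rewrite !addr0 (addf0 (linfD lf)) addr0.
Qed.

(** * The graded dual and its evaluations on formal sums *)

Section GradedDual.
Variables (K : fieldType) (V : int -> lmodType K).
Local Notation L := (dsum V).

Lemma dinj_in i (x : V i) : dinj x i = x.
Proof. exact: dfwith_in. Qed.

Lemma dinj_out i j (x : V i) : i != j -> dinj x j = 0.
Proof. exact: dfwith_out. Qed.

Lemma dinj_neq0 i j (x : V i) : dinj x j != 0 -> i = j.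
Proof. by apply: contraNeq => /dinj_out ->. Qed.

Lemma dinjD i : {morph @dinj K V i : x y / x + y}.
Proof. exact: linfD (dinj_linear (i := i)). Qed.

Lemma dinjZ i c (x : V i) : dinj (c *: x) = c *: dinj x.
Proof. exact: linfZ (dinj_linear (i := i)). Qed.

Lemma dsum_finite (X : L) : finite_set [set i | X i != 0].
Proof. by case: X => x /[dup] /asboolP. Qed.

Lemma dsum_dinj (X : L) : X = \sum_(i \in [set: int]) dinj (X i).
Proof.
have [A [XA {1}->]] := dsum_fset X.
by rewrite (fsbigTE A) // => i /XA ->; rewrite dinj0.
Qed.

Lemma dinj_finsup (X : L) : finsup (fun i => dinj (X i)).
Proof.
apply: (sub_finsup (dsum_finite X)) => i /=; apply: contraNN => /eqP ->.
by rewrite dinj0.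
Qed.

Record gdual := GDual {
  gd :> L -> K;
  gdD : {morph gd : x y / x + y};
  gdZ : forall c x, gd (c *: x) = c * gd x;
  gd_fin : finite_set [set i | exists x : V i, gd (dinj x) != 0] }.

Implicit Types F H T : gdual.

Lemma gd_sum F (X : L) : F X = \sum_(i \in [set: int]) F (dinj (X i)).
Proof. by rewrite {1}(dsum_dinj X) (addf_fsbigT (@gdD F) (dinj_finsup X)). Qed.

Lemma gdual_bilin F H i j :
  bilin (fun (x : V i) (y : V j) => F (dinj x) * H (dinj y) : K^o).
Proof.
split=> [v|u] c x y; rewrite dinjD dinjZ gdD gdZ.
  by rewrite mulrDl -mulrA.
by rewrite mulrDr mulrCA.
Qed.

Definition form2 F H (k : int * int) : tensor (V k.1) (V k.2) -> K^o :=
  tlift (fun x y => F (dinj x) * H (dinj y) : K^o).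

Definition test2 F H (S : ctens2 V) : K := csum (form2 F H) S.

Lemma form2_finform F H : finform (form2 F H).
Proof.
split=> [k|]; first exact: tlift_bilinD (gdual_bilin _ _ _ _).
apply: (sub_finite_set _ (finite_setX (gd_fin F) (gd_fin H))) => k [t].
move=> /tlift_neq0[x [y]]; rewrite mulf_eq0 negb_or => /andP[Fx Hy].
by split; [exists x|exists y].
Qed.

Lemma form2Z F H k c (t : tensor (V k.1) (V k.2)) :
  form2 F H (k := k) (c *: t) = c *: form2 F H (k := k) t.
Proof. exact: tlift_bilinZ (gdual_bilin _ _ _ _). Qed.

Lemma test2D F H : {morph test2 F H : S S' / S + S'}.
Proof. exact: csumD (form2_finform F H). Qed.

Lemma test2N F H : {morph test2 F H : S / - S}.
Proof. exact: addfN (test2D F H). Qed.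

Lemma test2B F H : {morph test2 F H : S S' / S - S'}.
Proof. exact: addfB (test2D F H). Qed.

Lemma test2_0 F H : test2 F H 0 = 0.
Proof. exact: addf0 (test2D F H). Qed.

Lemma test2Z F H c S : test2 F H (c *: S) = c * test2 F H S.
Proof. exact: (csumZ S (form2_finform F H) (fun k t => form2Z F H c t)). Qed.

Lemma test2_cot F H X Y : test2 F H (cot X Y) = F X * H Y.
Proof.
have tE k : form2 F H (cot X Y k) = F (dinj (X k.1)) * H (dinj (Y k.2)).
  by rewrite /form2 tlift_ot //; exact: gdual_bilin.
rewrite /test2 /csum (eq_fsbigT tE) fsbigT_pair /=; last first.
  apply: (sub_finsup (finite_setX (gd_fin F) (gd_fin H))) => k.
  rewrite mulf_eq0 negb_or => /andP[Fx Hy].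
  by split; [exists (X k.1)|exists (Y k.2)].
rewrite (gd_sum F X) (gd_sum H Y).
rewrite (addf_fsbigT (f := fun a : K => a * _)) => [||]; first last.
- by apply: (sub_finsup (gd_fin F)) => i; exists (X i).
- by move=> a b; rewrite mulrDl.
apply: eq_fsbigT => i; rewrite (addf_fsbigT (f := fun a : K => _ * a)) //.
  by move=> a b; rewrite mulrDr.
by apply: (sub_finsup (gd_fin H)) => j; exists (Y j).
Qed.

Lemma test2_cflip F H S : test2 F H (cflip S) = test2 H F S.
Proof.
rewrite /test2 /csum.
rewrite (@reindex_fsbigT _ _ _ (int * int)%type _ (fun k => (k.2, k.1))) /=; last first.
  by exists (fun k => (k.2, k.1)) => -[].
apply: eq_fsbigT => k; rewrite /cflip /form2 /tflip /=.
rewrite (addf_tlift _ _ (tlift_bilinD (gdual_bilin F H _ _))).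
by case: k => i j /=; apply: (@eq_tlift K _ _ K^o) => x y;
  rewrite tlift_ot 1?mulrC //; exact: gdual_bilin.
Qed.

End GradedDual.

(** * Transposes of locally finite maps, and tests with three functionals *)

Section Tests.
Variables (K : fieldType) (V : int -> lmodType K).
Local Notation L := (dsum V).
Implicit Types F H T : gdual V.

Section Pull.
Variables (J : choiceType) (W : J -> lmodType K) (g : forall k, W k -> K^o).
Arguments g : clear implicits.
Hypothesis gf : finform g.
Hypothesis gZ : forall k c t, g k (c *: t) = c *: g k t.
Variable f : L -> cprod W.
Hypotheses (flin : linear f) (ffin : loc_finite f).

Lemma gpullD : {morph (fun X => csum g (f X) : K) : x y / x + y}.
Proof. by move=> x y; rewrite (linfD flin) (csumD gf). Qed.

Lemma gpullZ c x : csum g (f (c *: x)) = c * csum g (f x).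
Proof. by rewrite (linfZ _ _ flin) (csumZ _ gf). Qed.

(** Only finitely many components k matter to g, and by local finiteness each of them is reached
    through f from finitely many degrees. Hence transposes of locally finite maps preserve the
    graded dual. *)
Lemma gpull_fin : finite_set [set i | exists x : V i, csum g (f (dinj x)) != 0].
Proof.
have fU := bigcup_finite gf.2 (fun k _ => ffin k).
apply: (sub_finite_set _ fU) => i [x]; apply: contraNP => nU.
apply/eqP/fsbigT0 => k; apply/eqP; apply: contra_notT nU => gn.
exists k; first by exists (f (dinj x) k).
by exists x; apply: contraNneq gn => ->; rewrite (addf0 (gf.1 k)) eqxx.
Qed.

Definition gpull : gdual V := GDual gpullD gpullZ gpull_fin.

End Pull.

Definition form1 F (i : int) : V i -> K^o := fun x => F (dinj x).

Lemma form1_finform F : finform (form1 F).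
Proof.
split=> [i x y|]; first by rewrite /form1 dinjD gdD.
exact: gd_fin.
Qed.

Lemma form1Z F i c (x : V i) : form1 F (c *: x) = c *: form1 F x.
Proof. by rewrite /form1 dinjZ gdZ. Qed.

Definition lfin (f : L -> L) : Prop :=
  linear f /\ loc_finite (fun x => dsum_val (f x)).

Lemma lfin_val f : lfin f -> linear (fun x => dsum_val (f x)).
Proof. by case=> fl _ c x y; rewrite fl. Qed.

(* Kept opaque, like gdelta, gtest and dual2 below, so that /= does not unfold the
   functional in favour of the sum defining it. *)
Lemma gcomp_sig F (f : L -> L) (hf : lfin f) : {G : gdual V | forall X, G X = F (f X)}.
Proof.
exists (gpull (form1_finform F) (form1Z F) (lfin_val hf) hf.2) => X.
by rewrite /= [RHS]gd_sum.
Qed.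

Definition gcomp F (f : L -> L) (hf : lfin f) : gdual V := sval (gcomp_sig F hf).

Lemma gcompE F f (hf : lfin f) X : gcomp F hf X = F (f X).
Proof. exact: svalP (gcomp_sig F hf) X. Qed.

Definition dfin (delta : L -> ctens2 V) : Prop := linear delta /\ loc_finite delta.

Lemma gdelta_sig F H delta (hd : dfin delta) :
  {G : gdual V | forall X, G X = test2 F H (delta X)}.
Proof. by exists (gpull (form2_finform F H) (form2Z F H) hd.1 hd.2). Qed.

Definition gdelta F H delta (hd : dfin delta) : gdual V := sval (gdelta_sig F H hd).

Lemma gdeltaE F H delta (hd : dfin delta) X :
  gdelta F H hd X = test2 F H (delta X).
Proof. exact: svalP (gdelta_sig F H hd) X. Qed.

Lemma test2_cmap F H f g (hf : lfin f) (hg : lfin g) S :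
  test2 F H (cmap f g S) = test2 (gcomp F hf) (gcomp H hg) S.
Proof.
rewrite /test2 csum_termwise; last 2 first.
- exact: form2_finform.
- move=> c; apply: (sub_finite_set _ (finite_setX (hf.2 c.1) (hg.2 c.2))).
  move=> k [x [y]]; rewrite /cot => xy; split; [exists x|exists y].
    apply: contraNneq xy => fx; rewrite /dcomp fx.
    by rewrite (addf0 (bilinDl (bilin_ot _ _) _)) eqxx.
  by apply: contraNneq xy => fy; rewrite /dcomp fy ot0r eqxx.
apply: eq_fsbigT => k; apply: (@eq_tlift K _ _ K^o) => x y.
by rewrite [LHS]test2_cot !gcompE.
Qed.

Lemma gdual_bilin2 F H T i j l :
  bilin (fun (x : V i) (w : tensor (V j) (V l)) =>
    F (dinj x) * form2 H T (k := (j, l)) w : K^o).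
Proof.
split=> [v|u] c x y.
  by rewrite dinjD dinjZ gdD gdZ mulrDl -mulrA.
by rewrite (form2_finform H T).1 form2Z mulrDr mulrCA.
Qed.

Definition form3 F H T (k : int * int * int) :
    tensor (V k.1.1) (tensor (V k.1.2) (V k.2)) -> K^o :=
  tlift (fun x w => F (dinj x) * form2 H T (k := (k.1.2, k.2)) w : K^o).

Definition test3 F H T (S : ctens3 V) : K := csum (form3 F H T) S.

Lemma form3_finform F H T : finform (form3 F H T).
Proof.
split=> [k|]; first exact: tlift_bilinD (gdual_bilin2 _ _ _ _ _ _).
have fs := finite_setX (finite_setX (gd_fin F) (gd_fin H)) (gd_fin T).
apply: (sub_finite_set _ fs) => k [t] /tlift_neq0[x [w]].
rewrite mulf_eq0 negb_or => /andP[Fx] /tlift_neq0[y [z]].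
rewrite mulf_eq0 negb_or => /andP[Hy Tz].
by split; [split; [exists x|exists y]|exists z].
Qed.

Lemma test3D F H T : {morph test3 F H T : S S' / S + S'}.
Proof. exact: csumD (form3_finform F H T). Qed.

Lemma test3B F H T : {morph test3 F H T : S S' / S - S'}.
Proof. exact: addfB (test3D F H T). Qed.

Lemma test3_0 F H T : test3 F H T 0 = 0.
Proof. exact: addf0 (test3D F H T). Qed.

Lemma test3_cot12 F H T X S : test3 F H T (cot12 X S) = F X * test2 H T S.
Proof.
have tE k : form3 F H T (cot12 X S k) =
    F (dinj (X k.1.1)) * form2 H T (S (k.1.2, k.2)).
  by rewrite /form3 tlift_ot //; exact: gdual_bilin2.
rewrite /test3 /csum (eq_fsbigT tE).
rewrite (@reindex_fsbigT _ _ _ (int * (int * int))%type _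
  (fun k => ((k.1, k.2.1), k.2.2))) /=; last first.
  by exists (fun k => (k.1.1, (k.1.2, k.2))) => [[i [j l]]|[[i j] l]].
have fS := csum_finsup S (form2_finform H T).
rewrite fsbigT_pair /=; last first.
  apply: (sub_finsup (finite_setX (gd_fin F) fS)) => -[i [j l]] /=.
  by rewrite mulf_eq0 negb_or => /andP[Fx Hy]; split; first exists (X i).
rewrite (gd_sum F X).
rewrite (addf_fsbigT (f := fun a : K => a * _)) => [||]; first last.
- by apply: (sub_finsup (gd_fin F)) => i; exists (X i).
- by move=> a b; rewrite mulrDl.
apply: eq_fsbigT => i; rewrite (addf_fsbigT (f := fun a : K => _ * a)) //.
  by apply: eq_fsbigT => -[j l].
by move=> a b; rewrite mulrDr.
Qed.

Lemma test3_cot21 F H T S X : test3 F H T (cot21 S X) = test2 F H S * T X.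
Proof.
have tE k : form3 F H T (cot21 S X k) =
    form2 F H (S (k.1.1, k.1.2)) * T (dinj (X k.2)).
  rewrite /form3 /cot21 (addf_tlift _ _ (tlift_bilinD (gdual_bilin2 F H T _ _ _))).
  rewrite /form2 /= tliftE mulr_suml; apply: eq_bigr => p _ /=.
  rewrite tlift_ot; last exact: gdual_bilin2.
  by rewrite /form2 tlift_ot ?mulrA //; exact: gdual_bilin.
rewrite /test3 /csum (eq_fsbigT tE).
have fS := csum_finsup S (form2_finform F H).
rewrite fsbigT_pair /=; last first.
  apply: (sub_finsup (finite_setX fS (gd_fin T))) => -[[i j] l] /=.
  by rewrite mulf_eq0 negb_or => /andP[Fx Hy]; split; last exists (X l).
rewrite (gd_sum T X).
rewrite (addf_fsbigT (f := fun a : K => a * _)) => [||//]; first last.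
  by move=> a b; rewrite mulrDl.
apply: eq_fsbigT => -[i j]; rewrite (addf_fsbigT (f := fun a : K => _ * a)) //.
  by move=> a b; rewrite mulrDr.
by apply: (sub_finsup (gd_fin T)) => l; exists (X l).
Qed.

Lemma test3_cflip12 F H T S : test3 F H T (cflip12 S) = test3 H F T S.
Proof.
rewrite /test3 /csum.
rewrite (@reindex_fsbigT _ _ _ (int * int * int)%type _
   (fun k => ((k.1.2, k.1.1), k.2))) /=; last first.
  by exists (fun k => ((k.1.2, k.1.1), k.2)) => -[[]].
apply: eq_fsbigT => -[[i j] l]; rewrite /cflip12 /form3 /=.
rewrite (addf_tlift _ _ (tlift_bilinD (gdual_bilin2 F H T _ _ _))).
apply: (@eq_tlift K _ _ K^o) => x w.
rewrite (addf_tlift _ _ (tlift_bilinD (gdual_bilin2 F H T _ _ _))).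
rewrite /form2 /= (@tliftE _ _ _ K^o) (@tliftE _ _ _ K^o) mulr_sumr.
apply: eq_bigr => p _ /=.
rewrite tlift_ot; last exact: gdual_bilin2.
by rewrite /form2 tlift_ot 1?mulrCA //; exact: gdual_bilin.
Qed.

Lemma bilin_otl i j l (z : V l) :
  bilin (fun (a : V i) (b : V j) => a \ot (b \ot z)).
Proof.
split=> [b|a] c x y; first exact: (bilin_ot _ _).1.
by rewrite (bilin_ot _ _).1 (bilin_ot _ _).2.
Qed.

(** [gdelta H T hd] is the product of H and T dual to delta, so iterated coproducts become iterated
    products of functionals. *)
Lemma test3_id_cdelta F H T delta (hd : dfin delta) S :
  test3 F H T (id_cdelta delta S) = test2 F (gdelta H T hd) S.
Proof.
rewrite /test3 csum_termwise; last 2 first.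
- exact: form3_finform.
- move=> c; apply: (sub_finite_set _ (finite_setX (finite_set1 c.1.1)
    (hd.2 (c.1.2, c.2)))) => k [x [y]]; rewrite /cot12 => xy; split.
    apply/eqP; apply: contraNT xy => nk; rewrite dinj_out //.
    by rewrite (addf0 (bilinDl (bilin_ot _ _) _)) eqxx.
  by exists y; apply: contraNneq xy => ->; rewrite ot0r eqxx.
apply: eq_fsbigT => k; apply: (@eq_tlift K _ _ K^o) => x y.
by rewrite [LHS]test3_cot12 gdeltaE.
Qed.

Lemma test3_cdelta_id F H T delta (hd : dfin delta) S :
  test3 F H T (cdelta_id delta S) = test2 (gdelta F H hd) T S.
Proof.
rewrite /test3 csum_termwise; last 2 first.
- exact: form3_finform.
- move=> c; apply: (sub_finite_set _ (finite_setX (hd.2 (c.1.1, c.1.2))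
    (finite_set1 c.2))) => k [x [y]]; rewrite /cot21 => xy; split.
    exists x; apply: contraNneq xy => ->.
    by rewrite (addf0 (tlift_bilinD (bilin_otl _ _ _))) eqxx.
  apply/eqP; apply: contraTT xy => nk; rewrite negbK; apply/eqP.
  by rewrite tliftE big1 // => p _; rewrite dinj_out // !ot0r.
apply: eq_fsbigT => k; apply: (@eq_tlift K _ _ K^o) => x y.
by rewrite [LHS]test3_cot21 gdeltaE.
Qed.

End Tests.

Lemma exchange_fsbigT_big (V : zmodType) (I : choiceType) (J : Type) (s : seq J)
    (F : I -> J -> V) : (forall j, finsup (F^~ j)) ->
  finsup (fun i => \sum_(j <- s) F i j) /\
  \sum_(i \in [set: I]) \sum_(j <- s) F i j =
  \sum_(j <- s) \sum_(i \in [set: I]) F i j.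
Proof.
move=> fF; elim: s => [|j s [fs IHs]].
  split; last by rewrite big_nil fsbigT0 // => i; rewrite big_nil.
  by apply: (sub_finsup (finite_set0 _)) => i; rewrite big_nil eqxx.
have E i : \sum_(j0 <- (j :: s)) F i j0 = F i j + \sum_(j0 <- s) F i j0.
  by rewrite big_cons.
split; last by rewrite (eq_fsbigT E) fsbigTD // IHs big_cons.
have fU : finite_set ([set i | F i j != 0] `|`
    [set i | \sum_(j0 <- s) F i j0 != 0]).
  by rewrite finite_setU; split=> //; exact: fF.
apply: (sub_finsup fU) => i; rewrite E => FG.
have [F0|Fn] := eqVneq (F i j) 0; last by left.
by right => /=; rewrite F0 add0r in FG.
Qed.

Section BilinConstructions.
Variable K : fieldType.

Lemma bilin_comp (U V U' V' W : lmodType K) (h : U -> V -> W)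
    (f : U' -> U) (g : V' -> V) : bilin h -> linear f -> linear g ->
  bilin (fun x y => h (f x) (g y)).
Proof.
by move=> hh lf lg; split=> [v|u] c x y; rewrite ?lf ?lg ?hh.1 ?hh.2.
Qed.

Lemma bilin_post (U V W W' : lmodType K) (h : U -> V -> W) (f : W -> W') :
  bilin h -> linear f -> bilin (fun x y => f (h x y)).
Proof. by move=> hh lf; split=> [v|u] c x y; rewrite ?hh.1 ?hh.2 lf. Qed.

Lemma linear_sub (U W : lmodType K) (h h' : U -> W) :
  linear h -> linear h' -> linear (fun x => h x - h' x).
Proof.
by move=> hh hh' c x y; rewrite hh hh' scalerBr opprD addrACA.
Qed.

Lemma bilin_sub (U V W : lmodType K) (h h' : U -> V -> W) :
  bilin h -> bilin h' -> bilin (fun x y => h x y - h' x y).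
Proof.
move=> hh hh'; split=> [v|u].
  exact: linear_sub (hh.1 v) (hh'.1 v).
exact: linear_sub (hh.2 u) (hh'.2 u).
Qed.

Lemma linear_idfun (U : lmodType K) : linear (fun x : U => x).
Proof. by []. Qed.

Lemma linear_tlift (U V X W : lmodType K) (h : X -> U -> V -> W) t :
  (forall u v, linear (fun x => h x u v)) -> linear (fun x => tlift (h x) t).
Proof.
move=> hl c x y; rewrite !tliftE scaler_sumr -big_split /=.
by apply: eq_bigr => p _; rewrite hl.
Qed.

Lemma bilin_tlift (U V X Y W : lmodType K) (h : X -> Y -> U -> V -> W) t :
  (forall u v, bilin (fun x y => h x y u v)) -> bilin (fun x y => tlift (h x y) t).
Proof.
move=> hb; split=> [y|x].
  by apply: linear_tlift => u v; exact: (hb u v).1.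
by apply: linear_tlift => u v; exact: (hb u v).2.
Qed.

End BilinConstructions.

(** * Separation of formal sums by functionals *)

Section Separation.
Variables (K : fieldType) (V : int -> lmodType K).
Local Notation L := (dsum V).
Implicit Types F H T : gdual V.

(* A finite dual basis of V p made of functionals in G that vanish on the other
   components. *)
Definition frame (G : gdual V -> Prop) (p : int) : Prop :=
  exists n (l : 'I_n -> gdual V) (w : 'I_n -> V p),
    [/\ forall i, G (l i),
        forall i j (x : V j), j != p -> l i (dinj x) = 0 &
        forall x, x = \sum_i l i (dinj x) *: w i].

Variable G : gdual V -> Prop.
Hypothesis fr : forall p, frame G p.

Lemma ot_sum (U W : lmodType K) m n (a : 'I_m -> K) (b : 'I_n -> K)
    (x : 'I_m -> U) (y : 'I_n -> W) :
  (\sum_i a i *: x i) \ot (\sum_j b j *: y j) =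
  \sum_i \sum_j (a i * b j) *: (x i \ot y j).
Proof.
rewrite (addf_sum (bilinDl (bilin_ot _ _) _)); apply: eq_bigr => i _.
rewrite (addf_sum (bilinDr (bilin_ot _ _) _)); apply: eq_bigr => j _.
by rewrite (bilinZl _ _ _ (bilin_ot _ _)) (bilinZr (bilin_ot _ _)) scalerA.
Qed.

(** The functionals of a frame vanish off their own component, so the sum in [test2] reduces to the
    component (p, q) and its value is the coefficient of [w i \ot w' j] in [S (p, q)]. *)
Lemma test2_sep (S : ctens2 V) :
  (forall F H, G F -> G H -> test2 F H S = 0) -> S = 0.
Proof.
move=> S0; apply: functional_extensionality_dep => -[p q].
have [m [l [w [Gl l0 wE]]]] := fr p; have [n [l' [w' [Gl' l0' wE']]]] := fr q.
have t0 i j : form2 (l i) (l' j) (S (p, q)) = 0.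
  rewrite -[RHS](S0 _ _ (Gl i) (Gl' j)) /test2 /csum.
  rewrite (@fsbigT_single _ _ _ (p, q)) // => -[p' q'] /=.
  rewrite xpair_eqE negb_and => /orP npq.
  rewrite /form2 tliftE big1 // => P _ /=.
  by case: npq => npq; rewrite ?(l0 _ _ _ npq) ?(l0' _ _ _ npq) ?mul0r ?mulr0.
rewrite [LHS]tensor_span tliftE.
under eq_bigr => P _.
  rewrite /= (wE P.1) (wE' P.2) ot_sum.
  over.
rewrite exchange_big big1 //= => i _; rewrite exchange_big big1 //= => j _.
by rewrite -scaler_suml -[X in X *: _]/(form2 (l i) (l' j) (S (p, q))) t0 scale0r.
Qed.

Lemma test3_sep (S : ctens3 V) :
  (forall F H T, G F -> G H -> G T -> test3 F H T S = 0) -> S = 0.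
Proof.
move=> S0; apply: functional_extensionality_dep => -[[p q] o].
have [m [l [w [Gl l0 wE]]]] := fr p; have [n [l' [w' [Gl' l0' wE']]]] := fr q.
have [s [l'' [w'' [Gl'' l0'' wE'']]]] := fr o.
have t0 i j k : form3 (l i) (l' j) (l'' k) (S (p, q, o)) = 0.
  rewrite -[RHS](S0 _ _ _ (Gl i) (Gl' j) (Gl'' k)) /test3 /csum.
  rewrite (@fsbigT_single _ _ _ (p, q, o)) // => -[[p' q'] o'] /=.
  rewrite !xpair_eqE !negb_and => /orP npqo.
  rewrite /form3 tliftE big1 // => P _ /=.
  rewrite /form2 tliftE mulr_sumr big1 // => P' _ /=.
  by case: npqo => [/orP[]|] npq; rewrite ?(l0 _ _ _ npq) ?(l0' _ _ _ npq)
    ?(l0'' _ _ _ npq) ?mul0r ?mulr0.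
(* The tensor of the last two slots is expanded first, so that the first slot can then be treated as
   in the case of two factors. *)
have tE (t : tensor (V q) (V o)) : t =
    \sum_j \sum_k (form2 (l' j) (l'' k) (k := (q, o)) t : K) *: (w' j \ot w'' k).
  rewrite [LHS]tensor_span tliftE.
  under eq_bigr => P _.
    rewrite /= (wE' P.1) (wE'' P.2) ot_sum.
    over.
  rewrite exchange_big; apply: eq_bigr => j _.
  rewrite exchange_big; apply: eq_bigr => k _.
  by rewrite -scaler_suml.
rewrite [LHS]tensor_span tliftE.
under eq_bigr => P _.
  rewrite /= (wE P.1) (tE P.2).
  rewrite (addf_sum (bilinDl (bilin_ot _ _) _)).
  under eq_bigr => i _.
    rewrite (addf_sum (bilinDr (bilin_ot _ _) _)).
    under eq_bigr => j _.
      rewrite (addf_sum (bilinDr (bilin_ot _ _) _)).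
      under eq_bigr => k _.
        rewrite (bilinZl _ _ _ (bilin_ot _ _)) (bilinZr (bilin_ot _ _)) scalerA.
        over.
      over.
    over.
  over.
rewrite exchange_big big1 //= => i _; rewrite exchange_big big1 //= => j _.
rewrite exchange_big big1 //= => k _.
rewrite -scaler_suml.
by rewrite -[X in X *: _]/(form3 (l i) (l' j) (l'' k) (S (p, q, o))) t0 scale0r.
Qed.

End Separation.

(** * Contractions of a homogeneous formal tensor *)

Section Contraction.
Variables (K : fieldType) (V : int -> lmodType K).
Local Notation L := (dsum V).
Implicit Types F H T : gdual V.

(** One degree of a bidegree in the support determines the other. A functional living in finitely
    many degrees therefore meets finitely many components of r, and its contraction with r lies in
    the direct sum. *)
Definition homogeneous (d : int) (r : ctens2 V) : Prop :=
  forall k, r k != 0 -> k.1 + k.2 = d.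

Variables (d : int) (r : ctens2 V).
Hypothesis rd : homogeneous d r.

Definition rho F : L := \sum_(k \in [set: int * int])
  tlift (fun x y => F (dinj x) *: dinj y) (r k).
Definition rho' F : L := \sum_(k \in [set: int * int])
  tlift (fun x y => F (dinj y) *: dinj x) (r k).

Lemma bilin_rho F i j : bilin (fun (x : V i) (y : V j) => F (dinj x) *: dinj y).
Proof.
split=> [y|x] c a b.
  by rewrite dinjD dinjZ gdD gdZ scalerDl scalerA.
by rewrite dinjD dinjZ scalerDr !scalerA mulrC.
Qed.

Lemma bilin_rho' F i j : bilin (fun (x : V i) (y : V j) => F (dinj y) *: dinj x).
Proof.
split=> [y|x] c a b.
  by rewrite dinjD dinjZ scalerDr !scalerA mulrC.
by rewrite dinjD dinjZ gdD gdZ scalerDl scalerA.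
Qed.

Lemma rhoE F H : H (rho F) = test2 F H r.
Proof.
rewrite /rho (addf_fsbigT (@gdD _ _ H)).
  apply: eq_fsbigT => k; rewrite (@addf_tlift _ _ _ _ K^o _ _ _ (@gdD _ _ H)).
  by apply: (@eq_tlift K _ _ K^o) => x y; rewrite gdZ.
have fi := finite_image (fun i => (i, d - i)) (gd_fin F).
apply: (sub_finsup fi) => -[i j] /= tn.
have ij : i + j = d.
  apply: (rd (k := (i, j))); apply: contraNneq tn => ->.
  by rewrite (addf0 (tlift_bilinD (bilin_rho F i j))) eqxx.
have [x [y]] := tlift_neq0 tn; rewrite scaler_eq0 negb_or => /andP[Fx _].
by exists i; [exists x|rewrite -ij addrC addKr].
Qed.

Lemma rho'E F H : F (rho' H) = test2 F H r.
Proof.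
rewrite /rho' (addf_fsbigT (@gdD _ _ F)).
  apply: eq_fsbigT => k; rewrite (@addf_tlift _ _ _ _ K^o _ _ _ (@gdD _ _ F)).
  by apply: (@eq_tlift K _ _ K^o) => x y; rewrite gdZ mulrC.
have fi := finite_image (fun j => (d - j, j)) (gd_fin H).
apply: (sub_finsup fi) => -[i j] /= tn.
have ij : i + j = d.
  apply: (rd (k := (i, j))); apply: contraNneq tn => ->.
  by rewrite (addf0 (tlift_bilinD (bilin_rho' H i j))) eqxx.
have [x [y]] := tlift_neq0 tn; rewrite scaler_eq0 negb_or => /andP[Fx _].
by exists j; [exists y|rewrite -ij addrK].
Qed.

End Contraction.

(** * Local finiteness of multiplications and of the coboundary *)

Section LocallyFinite.
Variables (K : fieldType) (V : int -> lmodType K).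
Local Notation L := (dsum V).
Implicit Types F H T : gdual V.

Lemma eq_test2 F F' H H' (S : ctens2 V) :
  F =1 F' -> H =1 H' -> test2 F H S = test2 F' H' S.
Proof.
move=> FF HH; apply: eq_fsbigT => k; apply: (@eq_tlift K _ _ K^o) => x y.
by rewrite FF HH.
Qed.

Lemma lfin_id : lfin (@id L).
Proof.
split=> // k; apply: (sub_finite_set _ (finite_set1 k)) => i [x] /=.
by move=> /dinj_neq0 ->.
Qed.

Lemma lfin_sub (f g : L -> L) : lfin f -> lfin g -> lfin (fun x => f x - g x).
Proof.
move=> [fl ff] [gl gf]; split; first exact: linear_sub.
move=> k; have fU := conj (ff k) (gf k); rewrite -finite_setU in fU.
apply: (sub_finite_set _ fU) => i [x].
rewrite -[dsum_val _ k]/(dsum_val (f (dinj x)) k - dsum_val (g (dinj x)) k) => fg.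
have [f0|] := eqVneq (dsum_val (f (dinj x)) k) 0; last by left; exists x.
by right; exists x; move: fg; rewrite f0 sub0r oppr_eq0.
Qed.

Lemma in_deg_dinj i (x : V i) : in_deg i (dinj x).
Proof. by move=> j ji; rewrite dinj_out // eq_sym. Qed.

Variable mul : L -> L -> L.
Hypotheses (mulb : bilin mul) (mulg : graded_mul mul).

Lemma mul_dinj_neq0 i j l (x : V i) (y : V j) :
  mul (dinj x) (dinj y) l != 0 -> i + j = l.
Proof.
move=> xy; have := mulg (in_deg_dinj x) (in_deg_dinj y).
by move=> /(_ l) xy0; apply/esym/eqP; apply: contraNT xy => /xy0 ->.
Qed.

Lemma dcomp_sum (I : Type) (s : seq I) (X : I -> L) k :
  (\sum_(i <- s) X i) k = \sum_(i <- s) X i k.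
Proof. exact: (addf_sum (f := fun Y : L => Y k)). Qed.

Lemma sum_neq0 (M : zmodType) (I : choiceType) (s : seq I) (X : I -> M) :
  \sum_(i <- s) X i != 0 -> exists2 i, i \in s & X i != 0.
Proof.
apply: contraNP => nX; rewrite big_seq big1 // => i si.
by apply/eqP; apply: contra_notT nX => Xi; exists i.
Qed.

(** X has finitely many degrees i, and degree k is reached only from degree k - i. *)
Lemma lfin_mull X : lfin (mul X).
Proof.
split; first exact: mulb.2.
move=> k; pose A := [set i | X i != 0].
have fA : finite_set A := dsum_finite X.
apply: (sub_finite_set _ (finite_image (fun i => k - i) fA)) => j [y].
rewrite -[dsum_val _ k]/(mul X (dinj y) k) {1}(dsum_dinj X).
rewrite (fsbigT_fset fA); last first.
  by move=> i; apply: contraNN => /eqP ->; rewrite dinj0.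
rewrite (addf_sum (bilinDl mulb _)) dcomp_sum.
move=> /sum_neq0[i]; rewrite in_fset_set // inE => Ai /mul_dinj_neq0 <-.
by exists i => //; rewrite addrC addKr.
Qed.

Lemma lfin_mulr X : lfin (mul^~ X).
Proof.
split; first exact: mulb.1.
move=> k; pose A := [set i | X i != 0].
have fA : finite_set A := dsum_finite X.
apply: (sub_finite_set _ (finite_image (fun i => k - i) fA)) => j [y].
rewrite -[dsum_val _ k]/(mul (dinj y) X k) {1}(dsum_dinj X).
rewrite (fsbigT_fset fA); last first.
  by move=> i; apply: contraNN => /eqP ->; rewrite dinj0.
rewrite (addf_sum (bilinDr mulb _)) dcomp_sum.
move=> /sum_neq0[i]; rewrite in_fset_set // inE => Ai /mul_dinj_neq0 <-.
by exists i => //; rewrite addrK.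
Qed.

Definition lfin_adl X : lfin (fun y => mul X y - mul y X) :=
  lfin_sub (lfin_mull X) (lfin_mulr X).
Definition lfin_adr X : lfin (fun y => mul y X - mul X y) :=
  lfin_sub (lfin_mulr X) (lfin_mull X).

Lemma test2_cmapl F H f (hf : lfin f) S :
  test2 F H (cmap f id S) = test2 (gcomp F hf) H S.
Proof.
rewrite (test2_cmap _ _ hf lfin_id); apply: eq_test2 => // X.
by rewrite gcompE.
Qed.

Lemma test2_cmapr F H f (hf : lfin f) S :
  test2 F H (cmap id f S) = test2 F (gcomp H hf) S.
Proof.
rewrite (test2_cmap _ _ lfin_id hf); apply: eq_test2 => // X.
by rewrite gcompE.
Qed.

Lemma test2_preLie_act F H X S : test2 F H (preLie_act mul X S) =
  test2 (gcomp F (lfin_mull X)) H S + test2 F (gcomp H (lfin_adl X)) S.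
Proof.
by rewrite test2D (test2_cmapl _ _ (lfin_mull X)) (test2_cmapr _ _ (lfin_adl X)).
Qed.

Variables (d : int) (r : ctens2 V).
Hypothesis rd : homogeneous d r.
Local Notation rho := (rho r).
Local Notation rho' := (rho' r).

(** This is the formula assumed for [star] on the dual side: contracting the slot on which the
    multiplication does not act leaves [rho' H] in the first slot and [rho F] in the second. *)
Lemma test2_coboundary F H X : test2 F H (coboundary mul r X) =
  - F (mul X (rho' H)) - (H (mul X (rho F)) - H (mul (rho F) X)).
Proof.
rewrite test2N test2_preLie_act -(rho'E rd) -(rhoE rd) !gcompE.
by rewrite (addfB (@gdD _ _ H)) opprD.
Qed.

Lemma cot_neq0 (X Y : L) k : cot X Y k != 0 -> X k.1 != 0 /\ Y k.2 != 0.
Proof.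
rewrite /cot => xy; split; apply: contraNneq xy => ->; last by rewrite ot0r.
by rewrite (addf0 (bilinDl (bilin_ot _ _) _)).
Qed.

Lemma bilin_cot : bilin (@cot K V).
Proof.
by split=> [y|x] c a b; apply: functional_extensionality_dep => k;
  [exact: (bilin_ot _ _).1|exact: (bilin_ot _ _).2].
Qed.

Lemma cmap_neq0 f g (hf : linear f) (hg : linear g) (S : ctens2 V) c :
  cmap f g S c != 0 -> exists k (x : V k.1) (y : V k.2),
    [/\ S k != 0, f (dinj x) c.1 != 0 & g (dinj y) c.2 != 0].
Proof.
rewrite /cmap /termwise /fsum => cn; apply: contrapT => nk; move: cn.
rewrite fsbigT0 ?eqxx // => k; apply/eqP; apply: contra_notT nk => tn.
exists k; have Sn : S k != 0.
  apply: contraNneq tn => ->.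
  have hb : bilin (fun (x : V k.1) (y : V k.2) => cot (f (dinj x)) (g (dinj y))).
    apply: (bilin_comp bilin_cot) => a x y; first by rewrite dinj_linear hf.
    by rewrite dinj_linear hg.
  by rewrite (addf0 (tlift_bilinD hb)) eqxx.
move: tn; rewrite (@addf_tlift _ _ _ _ _ (fun T : ctens2 V => T c)) //.
by move=> /tlift_neq0[x [y /cot_neq0[fx gy]]]; exists x, y.
Qed.

Hypothesis fr : forall p, frame (fun _ : gdual V => True) p.

Lemma coboundary_dfin : dfin (coboundary mul r).
Proof.
split=> [c X Y|k].
  (* [termwise] sums are not additive by definition, so linearity in the multiplier is read off from
     the tests, where it is that of [mul]. *)
  apply/eqP; rewrite -subr_eq0; apply/eqP/(test2_sep fr) => F H _ _.
  rewrite test2B test2D test2Z !test2_coboundary.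
  rewrite !(bilinDl mulb, bilinDr mulb, bilinZl _ _ _ mulb, bilinZr mulb).
  by rewrite !(gdD, gdZ); ring.
(* The coboundary raises total degree by d, so component k is reached from the single degree k.1 +
   k.2 - d. *)
apply: (sub_finite_set _ (finite_set1 (k.1 + k.2 - d))) => i [x].
rewrite -[X in X != 0]/(- (cmap (mul (dinj x)) id r k
  + cmap id (fun y => mul (dinj x) y - mul y (dinj x)) r k)) oppr_eq0 => tn.
have [c0|] := eqVneq (cmap (mul (dinj x)) id r k) 0; last first.
  move=> /(cmap_neq0 (lfin_mull _).1 lfin_id.1)[[i1 i2] [a [b [/rd /= <-]]]].
  move=> /mul_dinj_neq0 <- /dinj_neq0 <- /=.
  by ring.
move: tn; rewrite c0 add0r.
move=> /(cmap_neq0 lfin_id.1 (lfin_adl _).1)[[i1 i2] [a [b [/rd /= <-]]]].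
move=> /dinj_neq0 <- mn /=; suff <- : i + i2 = k.2 by ring.
have [m0|/mul_dinj_neq0 //] := eqVneq (mul (dinj x) (dinj b) k.2) 0.
move: mn; rewrite -[X in X != 0]/(mul (dinj x) (dinj b) k.2 - mul (dinj b) (dinj x) k.2).
by rewrite m0 sub0r oppr_eq0 => /mul_dinj_neq0 <-; rewrite addrC.
Qed.

End LocallyFinite.

(** * Quasi-triangular completed pre-Lie bialgebras *)

Section Bialgebra.
Variables (K : fieldType) (V : int -> lmodType K).
Local Notation L := (dsum V).
Implicit Types F H T : gdual V.
Variable mul : L -> L -> L.
Hypotheses (mulb : bilin mul) (mulg : graded_mul mul).
Variables (d : int) (r : ctens2 V).
Hypothesis rd : homogeneous d r.
Local Notation rho := (rho r).
Local Notation rho' := (rho' r).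

Lemma bilin_cot12 : bilin (@cot12 K V).
Proof.
by split=> [y|x] c a b; apply: functional_extensionality_dep => k;
  [exact: (bilin_ot _ _).1|exact: (bilin_ot _ _).2].
Qed.

Lemma cot3_neq0 (X Y Z : L) k : cot3 X Y Z k != 0 ->
  [/\ X k.1.1 != 0, Y k.1.2 != 0 & Z k.2 != 0].
Proof.
rewrite /cot3 /cot12 => xy.
have [|Yn Zn] := @cot_neq0 _ _ Y Z (k.1.2, k.2).
  by apply: contraNneq xy => ->; rewrite ot0r.
split=> //; apply: contraNneq xy => ->.
by rewrite (addf0 (bilinDl (bilin_ot _ _) _)).
Qed.

Definition Sform (A B A' B' : L) : ctens3 V :=
  cot3 (mul A A') B B' - cot3 A (mul B A') B'
  - cot3 A A' (mul B B' - mul B' B).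

Lemma bilin_Sforml i j A' B' :
  bilin (fun (a : V i) (b : V j) => Sform (dinj a) (dinj b) A' B').
Proof.
have li := @dinj_linear K V i; have lj := @dinj_linear K V j.
apply: bilin_sub; first apply: bilin_sub.
- apply: (bilin_comp (f := fun a : V i => mul (dinj a) A')
    (g := fun b : V j => cot (dinj b) B') bilin_cot12) => c x y.
    by rewrite li mulb.1.
  by rewrite lj (bilin_cot _).1.
- apply: (bilin_comp (g := fun b : V j => cot (mul (dinj b) A') B') bilin_cot12 li).
  by move=> c x y; rewrite lj mulb.1 (bilin_cot _).1.
- apply: (bilin_comp (g := fun b : V j =>
    cot A' (mul (dinj b) B' - mul B' (dinj b))) bilin_cot12 li) => c x y.
  by rewrite lj mulb.1 mulb.2 opprD addrACA -scalerBr (bilin_cot _).2.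
Qed.

Lemma bilin_Sformr i j A B :
  bilin (fun (a : V i) (b : V j) => Sform A B (dinj a) (dinj b)).
Proof.
have li := @dinj_linear K V i; have lj := @dinj_linear K V j.
apply: bilin_sub; first apply: bilin_sub.
- apply: (bilin_comp (f := fun a : V i => mul A (dinj a))
    (g := fun b : V j => cot B (dinj b)) bilin_cot12) => c x y.
    by rewrite li mulb.2.
  by rewrite lj (bilin_cot _).2.
- apply: bilin_post (bilin_cot12.2 A).
  apply: (bilin_comp (f := fun a : V i => mul B (dinj a)) (bilin_cot _) _ lj).
  by move=> c x y; rewrite li mulb.2.
- apply: bilin_post (bilin_cot12.2 A).
  apply: (bilin_comp (g := fun b : V j => mul B (dinj b) - mul (dinj b) B)
    (bilin_cot _) li) => c x y.
  by rewrite lj mulb.1 mulb.2 opprD addrACA -scalerBr.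
Qed.

Lemma S_termE k : S_term mul r k = tlift (fun a b => tlift (fun a' b' =>
  Sform (dinj a) (dinj b) (dinj a') (dinj b')) (r k.2)) (r k.1).
Proof. by []. Qed.

Lemma S_term_summable : summable (S_term mul r).
Proof.
move=> c; pose f i : int * int := (i, d - i).
have f2 p q : finite_set (f @` [set p; q]) by apply: finite_image; exact: finite_set2.
(* In each of the three products of the S-equation both copies of r have a leg left unmultiplied,
   whose slot in c fixes the bidegree of that copy. For the first copy this is the second leg in
   slot 2 or the first leg in slot 1; for the second copy, the second leg in slot 3 or the first leg
   in slot 2. *)
apply: (sub_finite_set _
  (finite_setX (f2 (d - c.1.2) c.1.1) (f2 (d - c.2) c.1.2))) => -[k k'] /=.
rewrite S_termE /= => Sn.
have rk : r k != 0.
  apply: contraNneq Sn => ->.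
  have hb : bilin (fun (a : V k.1) (b : V k.2) => tlift (fun a' b' =>
     Sform (dinj a) (dinj b) (dinj a') (dinj b')) (r k')).
    by apply: bilin_tlift => a' b'; exact: bilin_Sforml.
  by rewrite (addf0 (tlift_bilinD hb)) eqxx.
move: Sn; rewrite (@addf_tlift _ _ _ _ _ (fun S : ctens3 V => S c)) //.
move=> /tlift_neq0[a [b]] Sn.
have rk' : r k' != 0.
  apply: contraNneq Sn => ->.
  by rewrite (addf0 (tlift_bilinD (bilin_Sformr _ _ _ _))) eqxx.
move: Sn; rewrite (@addf_tlift _ _ _ _ _ (fun S : ctens3 V => S c)) //.
move=> /tlift_neq0[a' [b']] Sn.
have fE (x : int * int) i : r x != 0 -> x.1 = i -> f i = x.
  by move=> rx <-; rewrite /f -(rd rx) addrC addKr -surjective_pairing.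
have gE (x : int * int) i : r x != 0 -> x.2 = i -> f (d - i) = x.
  by move=> rx <-; apply: fE => //; rewrite -(rd rx) addrK.
have [c1|/cot3_neq0[m1 m2 m3]] :=
  eqVneq (cot3 (mul (dinj a) (dinj a')) (dinj b) (dinj b') c) 0; last first.
  split; first by exists (d - c.1.2); [left|exact: gE rk (dinj_neq0 m2)].
  by exists (d - c.2); [left|exact: gE rk' (dinj_neq0 m3)].
have [c2|/cot3_neq0[m1 m2 m3]] :=
  eqVneq (cot3 (dinj a) (mul (dinj b) (dinj a')) (dinj b') c) 0; last first.
  split; first by exists c.1.1; [right|exact: fE rk (dinj_neq0 m1)].
  by exists (d - c.2); [left|exact: gE rk' (dinj_neq0 m3)].
move: Sn; rewrite /Sform -[X in X != 0]/(
   cot3 (mul (dinj a) (dinj a')) (dinj b) (dinj b') c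
   - cot3 (dinj a) (mul (dinj b) (dinj a')) (dinj b') c - cot3 (dinj a) (dinj a') _ c).
rewrite c1 c2 subr0 sub0r oppr_eq0 => /cot3_neq0[m1 m2 m3].
split; first by exists c.1.1; [right|exact: fE rk (dinj_neq0 m1)].
by exists c.1.2; [right|exact: fE rk' (dinj_neq0 m2)].
Qed.

Lemma test3_cot3 F H T X Y Z : test3 F H T (cot3 X Y Z) = F X * (H Y * T Z).
Proof. by rewrite test3_cot12 test2_cot. Qed.

(** Contracting the second copy of r and then the first turns the sum over pairs of bidegrees into
    products of contractions. This supplies the S-equation in the form used on the dual side. *)
Lemma test3_S_term F H T : test3 F H T (fsum (S_term mul r)) =
  F (mul (rho' H) (rho' T)) - H (mul (rho F) (rho' T))
  - (T (mul (rho F) (rho H)) - T (mul (rho H) (rho F))).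
Proof.
have f3 := form3_finform F H T.
have sS := S_term_summable.
rewrite /test3 csum_fsum // fsbigT_pair; last first.
  have fU := bigcup_finite f3.2 (fun c _ => sS c).
  apply: (sub_finsup fU) => k; apply: contraNP => nU; apply/eqP/fsbigT0 => c.
  apply/eqP; apply: contra_notT nU => gn.
  exists c; first by exists (S_term mul r k c).
  by rewrite /=; apply: contraNneq gn => ->; rewrite (addf0 (f3.1 c)) eqxx.
(* Contraction of the second copy of r, with the two legs of the first copy frozen as A and B. The
   result is bilinear in A and B, so the first copy can be contracted next. *)
have innerE A B :
    finsup (fun k => tlift (fun a' b' =>
      test3 F H T (Sform A B (dinj a') (dinj b')) : K^o) (r k)) /\
    \sum_(k \in [set: int * int])
      tlift (fun a' b' => test3 F H T (Sform A B (dinj a') (dinj b')) : K^o) (r k) =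
    H B * F (mul A (rho' T)) - F A * H (mul B (rho' T))
    - F A * (T (mul B (rho H)) - T (mul (rho H) B)).
  have tE k : tlift (fun a' b' =>
        test3 F H T (Sform A B (dinj a') (dinj b')) : K^o) (r k) =
      H B * form2 (gcomp F (lfin_mull mulb mulg A)) T (r k)
      + - (F A * form2 (gcomp H (lfin_mull mulb mulg B)) T (r k))
      + - (F A * form2 H (gcomp T (lfin_adl mulb mulg B)) (r k)).
    rewrite /form2 !(@tliftE _ _ _ K^o) !mulr_sumr -!sumrN -!big_split /=.
    apply: eq_bigr => p _; rewrite !test3B !test3_cot3 !gcompE.
    by ring.
  have fin1 c G1 G2 : finsup (fun k => c * form2 G1 G2 (r k) : K).
    apply: (sub_finsup (csum_finsup r (form2_finform G1 G2))) => k.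
    by apply: contraNN => /eqP ->; rewrite mulr0.
  have sumE c G1 G2 :
      \sum_(k \in [set: int * int]) (c * form2 G1 G2 (r k) : K) = c * test2 G1 G2 r.
    rewrite /test2 /csum (addf_fsbigT (f := fun a : K => c * a)) //.
      by move=> a b; rewrite mulrDr.
    exact: (csum_finsup r (form2_finform G1 G2)).
  split.
    rewrite (_ : (fun k => _) = (fun k =>
      H B * form2 (gcomp F (lfin_mull mulb mulg A)) T (r k)
      + - (F A * form2 (gcomp H (lfin_mull mulb mulg B)) T (r k))
      + - (F A * form2 H (gcomp T (lfin_adl mulb mulg B)) (r k)))).
      by do ![exact: fin1|apply: finsupD|apply: finsupN].
    by apply/funext => k; exact: tE.
  rewrite (eq_fsbigT tE) fsbigTD ?fsbigTD ?fsbigTN ?sumE; try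
    by do ![exact: fin1|apply: finsupD|apply: finsupN].
  rewrite -(rhoE rd H) -!(rho'E rd) !gcompE (addfB (@gdD _ _ T)).
  by ring.
have outerE (k : int * int) : \sum_(k' \in [set: int * int])
    csum (form3 F H T) (S_term mul r (k, k')) =
    form2 (gcomp F (lfin_mulr mulb mulg (rho' T))) H (r k)
    - form2 F (gcomp H (lfin_mulr mulb mulg (rho' T))) (r k)
    - form2 F (gcomp T (lfin_adr mulb mulg (rho H))) (r k).
  have eE k' : csum (form3 F H T) (S_term mul r (k, k')) =
      \sum_(p <- repr (r k)) (tlift (fun a' b' => test3 F H T
         (Sform (dinj p.1) (dinj p.2) (dinj a') (dinj b')) : K^o) (r k') : K).
    rewrite S_termE /= (@addf_tlift _ _ _ _ K^o _ _ _ (csumD f3)) tliftE.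
    apply: eq_bigr => p _.
    by rewrite (@addf_tlift _ _ _ _ K^o _ _ _ (csumD f3)).
  rewrite (eq_fsbigT eE) (exchange_fsbigT_big _ (fun p => (innerE _ _).1)).2.
  rewrite /form2 !(@tliftE _ _ _ K^o) -!sumrN -!big_split /=.
  apply: eq_bigr => p _; rewrite (innerE _ _).2 !gcompE (addfB (@gdD _ _ T)).
  by ring.
have fin2 G1 G2 := csum_finsup r (form2_finform G1 G2).
rewrite (eq_fsbigT outerE) !fsbigTD ?fsbigTN; try
  by do ![exact: fin2|apply: finsupD|apply: finsupN].
rewrite -![\sum_(k \in _) form2 _ _ _]/(test2 _ _ r).
by rewrite -(rho'E rd _ H) -!(rhoE rd F) !gcompE (addfB (@gdD _ _ T)).
Qed.

Hypothesis mulP : forall x y z,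
  mul (mul x y) z - mul x (mul y z) = mul (mul y x) z - mul y (mul x z).
Hypothesis fr : forall p, frame (fun _ : gdual V => True) p.
Hypothesis rS : S_equation mul r.
Hypothesis rinv : forall x, preLie_act mul x (r - cflip r) = 0.

Let GL F a := gcomp F (lfin_mull mulb mulg a).
Let GR F a := gcomp F (lfin_mulr mulb mulg a).
Let del := coboundary_dfin mulb mulg rd fr.
Let star F H := gdelta F H del.

Let evGL F x y : GL F x y = F (mul x y). Proof. exact: gcompE. Qed.
Let evGR F x y : GR F x y = F (mul y x). Proof. exact: gcompE. Qed.
Let evN F : {morph F : x / - x}. Proof. exact: addfN (@gdD _ _ F). Qed.
Let rhoS F H : F (rho' H) = H (rho F). Proof. by rewrite (rho'E rd) (rhoE rd). Qed.

Let starE F H x : star F H x =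
  - F (mul x (rho' H)) - (H (mul x (rho F)) - H (mul (rho F) x)).
Proof. by rewrite gdeltaE (test2_coboundary mulb mulg rd). Qed.

Let S0 F H T : F (mul (rho' H) (rho' T)) - H (mul (rho F) (rho' T))
  - (T (mul (rho F) (rho H)) - T (mul (rho H) (rho F))) = 0.
Proof. by rewrite -test3_S_term rS.2 test3_0. Qed.

Let inv0 x F H : F (mul x (rho H)) - F (mul x (rho' H)) =
  (H (mul x (rho F)) - H (mul (rho F) x))
  - (H (mul x (rho' F)) - H (mul (rho' F) x)).
Proof.
have := congr1 (test2 F H) (rinv x).
rewrite (test2_preLie_act mulb mulg) test2_0 !test2B !test2_cflip.
rewrite -(rho'E rd _ H) -(rhoE rd H) -(rhoE rd F) -(rho'E rd _ F) !gcompE.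
rewrite !(addfB (@gdD _ _ H)) => E.
by lincomb (-1) E; ring.
Qed.

Lemma coboundary_coalgebra : completed_preLie_coalgebra (coboundary mul r).
Proof.
split; [exact: del.1|exact: del.2|move=> x].
apply/eqP; rewrite -subr_eq0; apply/eqP/(test3_sep fr) => F H T _ _ _.
rewrite !test3B !test3_cflip12 !(test3_id_cdelta _ _ _ del).
rewrite !(test3_cdelta_id _ _ _ del) -!(gdeltaE _ _ del).
have := star_preLie (@gdD _ _) evN mulP evGL evGR rhoS starE S0 inv0 F H T x.
by rewrite /star => ->; rewrite subrr.
Qed.

Lemma coboundary_compat1 a b :
  let delta := coboundary mul r in
  (delta (mul a b) - cflip (delta (mul a b)))
  - cmap (mul a) id (delta b - cflip (delta b))
  - cmap id (mul a) (delta b - cflip (delta b))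
  - cmap id (mul^~ b) (delta a)
  + cmap (mul^~ b) id (cflip (delta a)) = 0.
Proof.
move=> delta; apply: (test2_sep fr) => F H _ _.
rewrite test2D !test2B.
rewrite (test2_cmapl _ _ (lfin_mull mulb mulg a)).
rewrite (test2_cmapl _ _ (lfin_mulr mulb mulg b)).
rewrite (test2_cmapr _ _ (lfin_mull mulb mulg a)).
rewrite (test2_cmapr _ _ (lfin_mulr mulb mulg b)).
rewrite !test2B !test2_cflip -!(gdeltaE _ _ del).
exact: (star_compat1 (@gdD _ _) evN mulP evGL evGR rhoS starE inv0 F H a b).
Qed.

(** This is the 1-cocycle condition for the commutator Lie algebra acting by L(x) (x) I + I (x)
    ad(x), and a coboundary is a cocycle because this is a representation: the instance under F says
    so for L, and the three under H form the Jacobi identity for a, b and [rho F]. *)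
Lemma coboundary_compat2 a b :
  let delta := coboundary mul r in
  delta (mul a b - mul b a)
  - cmap id (fun x => mul x b - mul b x) (delta a)
  - cmap id (fun x => mul a x - mul x a) (delta b)
  - cmap (mul a) id (delta b)
  + cmap (mul b) id (delta a) = 0.
Proof.
move=> delta; apply: (test2_sep fr) => F H _ _.
rewrite test2D !test2B.
rewrite !(test2_cmapl _ _ (lfin_mull mulb mulg _)).
rewrite (test2_cmapr _ _ (lfin_adr mulb mulg b)) (test2_cmapr _ _ (lfin_adl mulb mulg a)).
rewrite !(test2_coboundary mulb mulg rd) !gcompE.
have GLr x (G : gdual V) : F (mul x (rho' G)) = G (rho (GL F x)) by rewrite -rhoS evGL.
rewrite -/(GL F a) -/(GL F b).
rewrite [F (mul a (rho' (gcomp _ _)))]GLr [F (mul b (rho' (gcomp _ _)))]GLr !gcompE.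
have pl (G : gdual V) x y z : G (mul (mul x y) z) - G (mul x (mul y z)) =
    G (mul (mul y x) z) - G (mul y (mul x z)) by rewrite -!evN -!(@gdD _ _ G) mulP.
rewrite !(bilinDl mulb, bilinDr mulb, addfN (bilinDl mulb _), addfN (bilinDr mulb _)).
rewrite !(gdD, evN).
lincomb (-1) (pl F a b (rho' H)); lincomb (-1) (pl H a b (rho F)).
lincomb 1 (pl H a (rho F) b); lincomb (-1) (pl H b (rho F) a).
by ring.
Qed.

Theorem coboundary_quasi_triangular :
  completed_quasi_triangular mul (coboundary mul r) r.
Proof.
split=> //; split.
- by split; [exact: mulb|exact: mulP].
- exact: coboundary_coalgebra.
- by move=> a; exact: (lfin_mull mulb mulg a).2.
- by move=> a; exact: (lfin_mulr mulb mulg a).2.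
- exact: coboundary_compat1.
- exact: coboundary_compat2.
Qed.

End Bialgebra.

(** * The affinization *)

Section Dual.
Variable K : fieldType.

Record dual (U : lmodType K) := Dual {
  dual_fun :> U -> K;
  dualD : {morph dual_fun : x y / x + y};
  dualZ : forall c x, dual_fun (c *: x) = c * dual_fun x }.

Lemma dualN (U : lmodType K) (xi : dual U) : {morph xi : x / - x}.
Proof. exact: addfN (@dualD _ xi). Qed.

Lemma dual_sum (U : lmodType K) (xi : dual U) (I : Type) (s : seq I) (F : I -> U) :
  xi (\sum_(i <- s) F i) = \sum_(i <- s) xi (F i).
Proof. exact: addf_sum (@dualD _ xi) _ _ _. Qed.

(** Finite dimension as a finite dual basis, which keeps P and the components of Q plain modules, as
    the tensor and direct sum constructions expect. *)
Definition fdim (U : lmodType K) : Prop :=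
  exists n (l : 'I_n -> dual U) (w : 'I_n -> U), forall x, x = \sum_i l i x *: w i.

Lemma vect_fdim (U : vectType K) : fdim U.
Proof.
pose b := vbasis (fullv : {vspace U}).
have cD i : {morph coord b i : x y / x + y} by move=> x y; rewrite linearD.
have cZ i c x : coord b i (c *: x) = c * coord b i x by rewrite linearZ.
exists (\dim (fullv : {vspace U})), (fun i => Dual (cD i) (cZ i)), (fun i => b`_i).
by move=> x; exact: coord_vbasis (memvf x).
Qed.

Lemma dual_bilin (U W : lmodType K) (xi : dual U) (eta : dual W) :
  bilin (fun x y => xi x * eta y : K^o).
Proof.
split=> [v|u] c x y; rewrite dualD dualZ; first by rewrite mulrDl -mulrA.
by rewrite mulrDr mulrCA.
Qed.

Lemma dual2_sig (U W : lmodType K) (xi : dual U) (eta : dual W) :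
  {zeta : dual (tensor U W) | forall x y, zeta (x \ot y) = xi x * eta y}.
Proof.
have bl := dual_bilin xi eta.
exists (Dual (tlift_bilinD bl) (fun c s => tlift_bilinZ c s bl)) => x y.
exact: (tlift_ot _ _ bl).
Qed.

Definition dual2 (U W : lmodType K) (xi : dual U) (eta : dual W) : dual (tensor U W) :=
  sval (dual2_sig xi eta).

Lemma dual2_ot (U W : lmodType K) (xi : dual U) (eta : dual W) x y :
  dual2 xi eta (x \ot y) = xi x * eta y.
Proof. exact: svalP (dual2_sig xi eta) x y. Qed.

Lemma dual2E (U W : lmodType K) (xi : dual U) (eta : dual W) s :
  dual2 xi eta s = tlift (fun x y => xi x * eta y : K^o) s.
Proof.
rewrite {1}(tensor_span s).
rewrite (@addf_tlift _ _ _ _ K^o (dual2 xi eta) _ _ (@dualD _ (dual2 xi eta))).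
by apply: (@eq_tlift K _ _ K^o) => x y; rewrite dual2_ot.
Qed.

Lemma dual2_tflip (U W : lmodType K) (xi : dual U) (eta : dual W) s :
  dual2 xi eta (tflip s) = dual2 eta xi s.
Proof.
rewrite [RHS]dual2E /tflip.
rewrite (@addf_tlift _ _ _ _ K^o (dual2 xi eta) _ _ (@dualD _ (dual2 xi eta))).
by apply: (@eq_tlift K _ _ K^o) => x y; rewrite dual2_ot mulrC.
Qed.

End Dual.

(** * The product on P (x) Q *)

Section PQ.
Variables (K : fieldType) (P : lmodType K) (Q : int -> lmodType K).
Local Notation PQ := (dsum (PQ_comp P Q)).

Lemma PQ_pure_bilin : bilin (@PQ_pure K P Q).
Proof.
split=> [x c a b|a c x y]; apply: val_inj; apply: functional_extensionality_dep => i.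
  exact: (bilin_ot _ _).1.
exact: (bilin_ot _ _).2.
Qed.

Lemma dinj_ot i a (x : Q i) :
  dinj (a \ot x : PQ_comp P Q i) = PQ_pure a (dinj x).
Proof.
apply: val_inj; apply: functional_extensionality_dep => j.
rewrite -[LHS]/(dinj (a \ot x : PQ_comp P Q i) j) -[RHS]/(a \ot dinj x j).
have [<-|ij] := eqVneq i j; first by rewrite !dinj_in.
by rewrite !dinj_out // ot0r.
Qed.

Lemma dinj_PQ_span i (t : PQ_comp P Q i) :
  dinj t = \sum_(p <- repr (t : tensor P (Q i))) PQ_pure p.1 (dinj p.2).
Proof.
rewrite {1}(tensor_span (t : tensor P (Q i))) tliftE.
rewrite (addf_sum (@dinjD _ (PQ_comp P Q) i)).
by apply: eq_bigr => p _; rewrite dinj_ot.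
Qed.

Lemma PQ_span (X : PQ) : exists s : seq (P * dsum Q),
  X = \sum_(p <- s) PQ_pure p.1 p.2.
Proof.
have [A [_ ->]] := dsum_fset X.
elim: (A : seq int) => [|i s [t IHt]]; first by exists [::]; rewrite !big_nil.
rewrite big_cons IHt dinj_PQ_span.
exists ([seq (p.1, dinj p.2) | p <- repr (X i : tensor P (Q i))] ++ t).
by rewrite big_cat /= big_map.
Qed.

Lemma PQ_lift_linear (W : lmodType K) (h : P -> dsum Q -> W) :
  bilin h -> linear (PQ_lift h).
Proof.
move=> hh.
have hb i : bilin (fun a (x : Q i) => h a (dinj x)).
  by split=> [x|a] c y z; [exact: hh.1|rewrite dinj_linear hh.2].
have fs (X : PQ) : finsup (fun i => tlift (fun a (x : Q i) => h a (dinj x)) (X i)).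
  apply: (sub_finsup (dsum_finite X)) => i /=; apply: contraNN => /eqP ->.
  by rewrite (addf0 (tlift_bilinD (hb i))).
move=> c X Y; rewrite /PQ_lift /dlift.
rewrite (addf_fsbigT (@scalerDr _ _ c)) // -fsbigTD //.
  by apply: eq_fsbigT => i; exact: tlift_linear (hb i) _ _ _.
apply: (sub_finsup (dsum_finite X)) => i /=; apply: contraNN => /eqP ->.
by rewrite (addf0 (tlift_bilinD (hb i))) scaler0.
Qed.

Lemma PQ_lift_ext (W : lmodType K) (h : P -> dsum Q -> W) (f : PQ -> W) X :
  linear f -> (forall a x, h a x = f (PQ_pure a x)) -> PQ_lift h X = f X.
Proof.
move=> fl hE; have hb : bilin h.
  by split=> [x|a] c y z; rewrite !hE ?PQ_pure_bilin.1 ?PQ_pure_bilin.2 fl.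
have [s ->] := PQ_span X; rewrite (addf_sum (linfD fl)).
rewrite (addf_sum (linfD (PQ_lift_linear hb))); apply: eq_bigr => p _.
by rewrite PQ_lift_pure.
Qed.

Variables (rhd lhd : P -> P -> P) (circ : dsum Q -> dsum Q -> dsum Q).
Hypotheses (rhdb : bilin rhd) (lhdb : bilin lhd) (circb : bilin circ).
Local Notation mul := (PQ_mul rhd lhd circ).

Let h1 a x b y : PQ :=
  PQ_pure (rhd a b) (circ x y) - PQ_pure (lhd b a) (circ y x).

Let h1r a x : bilin (h1 a x).
Proof.
apply: bilin_sub.
  by apply: (bilin_comp PQ_pure_bilin); [exact: rhdb.2|exact: circb.2].
by apply: (bilin_comp PQ_pure_bilin); [exact: lhdb.1|exact: circb.1].
Qed.

Let h1l b y : bilin (fun a x => h1 a x b y).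
Proof.
apply: bilin_sub.
  by apply: (bilin_comp PQ_pure_bilin); [exact: rhdb.1|exact: circb.1].
by apply: (bilin_comp PQ_pure_bilin); [exact: lhdb.2|exact: circb.2].
Qed.

Let PQ_lift_arg Y : bilin (fun a x => PQ_lift (h1 a x) Y).
Proof.
have [s ->] := PQ_span Y.
have E a x : PQ_lift (h1 a x) (\sum_(p <- s) PQ_pure p.1 p.2) =
    \sum_(p <- s) h1 a x p.1 p.2.
  rewrite (addf_sum (linfD (PQ_lift_linear (h1r a x)))).
  by apply: eq_bigr => p _; rewrite PQ_lift_pure.
split=> [x|a] c y z; rewrite !E scaler_sumr -big_split /=.
  by apply: eq_bigr => p _; rewrite (h1l _ _).1.
by apply: eq_bigr => p _; rewrite (h1l _ _).2.
Qed.

Lemma PQ_mul_bilin : bilin mul.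
Proof.
split=> [Y|X]; first exact: PQ_lift_linear (PQ_lift_arg Y).
move=> c Y Z; have [s ->] := PQ_span X.
rewrite /PQ_mul !(addf_sum (linfD (PQ_lift_linear (PQ_lift_arg _)))).
rewrite scaler_sumr -big_split /=; apply: eq_bigr => p _.
by rewrite !PQ_lift_pure //; exact: (PQ_lift_linear (h1r p.1 p.2)).
Qed.

Lemma PQ_mul_pure a x b y : mul (PQ_pure a x) (PQ_pure b y) =
  PQ_pure (rhd a b) (circ x y) - PQ_pure (lhd b a) (circ y x).
Proof.
by rewrite /PQ_mul (PQ_lift_pure _ _ (PQ_lift_arg _)) (PQ_lift_pure _ _ (h1r _ _)).
Qed.

Lemma in_deg_sum (V : int -> lmodType K) (I : Type) (s : seq I) (X : I -> dsum V) i :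
  (forall j, in_deg i (X j)) -> in_deg i (\sum_(j <- s) X j).
Proof. by move=> Xi k ki; rewrite dcomp_sum big1 // => j _; exact: Xi. Qed.

Lemma in_deg_eq (V : int -> lmodType K) (X : dsum V) i : in_deg i X -> X = dinj (X i).
Proof.
move=> Xi; rewrite {1}(dsum_dinj X); apply: fsbigT_single => j ji.
by rewrite Xi // dinj0.
Qed.

Lemma in_deg_pure i (a : P) (x : dsum Q) : in_deg i x -> in_deg i (PQ_pure a x).
Proof.
by move=> xi j ji; rewrite -[LHS]/(a \ot x j) xi // ot0r.
Qed.

Lemma PQ_mul_graded : graded_mul circ -> graded_mul mul.
Proof.
move=> gc i j X Y Xi Yj; rewrite (in_deg_eq Xi) (in_deg_eq Yj) !dinj_PQ_span.
rewrite (addf_sum (bilinDl PQ_mul_bilin _)); apply: in_deg_sum => p.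
rewrite (addf_sum (bilinDr PQ_mul_bilin _)); apply: in_deg_sum => q.
rewrite PQ_mul_pure => k kij.
have c1 := gc _ _ _ _ (in_deg_dinj p.2) (in_deg_dinj q.2).
have c2 := gc _ _ _ _ (in_deg_dinj q.2) (in_deg_dinj p.2).
rewrite -[LHS]/(PQ_pure (rhd p.1 q.1) (circ (dinj p.2) (dinj q.2)) k -
  PQ_pure (lhd q.1 p.1) (circ (dinj q.2) (dinj p.2)) k).
rewrite (in_deg_pure _ c1) // (in_deg_pure _ c2) ?subr0 //.
by rewrite addrC.
Qed.

End PQ.

(** * The invariant form, its dual bases and the test functionals *)

Section Quadratic.
Variables (K : fieldType) (P : lmodType K) (Q : int -> lmodType K).
Local Notation L := (dsum Q).
Local Notation PQ := (dsum (PQ_comp P Q)).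
Variables (circ : L -> L -> L) (varpi : L -> L -> K).
Hypothesis hQ : quadratic_graded_Leibniz circ varpi.
Variables (Omega : choiceType) (e f : Omega -> L).
Hypotheses (he : homogeneous_basis e) (hf : homogeneous_dual_basis varpi e f).
Hypotheses (Pfd : fdim P) (Qfd : forall p, fdim (Q p)).

Let vb := form_bilin hQ.
Let cb := Leibniz_bilin hQ.

Lemma varpiDl y : {morph varpi^~ y : x z / x + z}. Proof. exact: bilinDl vb y. Qed.
Lemma varpiDr x : {morph varpi x : y z / y + z}. Proof. exact: bilinDr vb x. Qed.
Lemma varpiZl c x y : varpi (c *: x) y = c * varpi x y.
Proof. exact: bilinZl c x y vb. Qed.
Lemma varpiZr c x y : varpi x (c *: y) = c * varpi x y.
Proof. exact: bilinZr vb c x y. Qed.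

Lemma varpi_swap x y z : varpi (circ x y) z = varpi (circ x z) y.
Proof. by rewrite !(form_invariant hQ) addrC. Qed.

(** By [varpi_swap], [varpi (circ x y) z] is symmetric in y and z, so the six arrangements of x, y,
    z give three scalars, one for each left factor; this lemma says that they sum to zero. *)
Lemma varpi_cycle x y z :
  varpi (circ z x) y = - varpi (circ x y) z - varpi (circ y x) z.
Proof.
rewrite [X in - X - _](form_invariant hQ) (form_skew hQ x) varpiDl.
by rewrite (varpi_swap y z x) (varpi_swap z y x); ring.
Qed.

(** The form pairs degree j only with degree - m - j, and y has finitely many degrees. *)
Lemma gform_fin y : finite_set [set i | exists x : Q i, varpi (dinj x) y != 0].
Proof.
have [m mE] := form_graded hQ.
apply: (sub_finite_set _ (finite_image (fun j => - m - j) (dsum_finite y))) => i [x].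
rewrite {1}(dsum_dinj y) (addf_fsbigT (@varpiDr _) (dinj_finsup y)) => vn.
have [j vj] : exists j, varpi (dinj x) (dinj (y j)) != 0.
  apply: contrapT => nj; move: vn; rewrite fsbigT0 ?eqxx // => j.
  by apply/eqP; apply: contra_notT nj => vj; exists j.
have ijm : i + j + m = 0.
  apply/eqP; apply: contraNT vj => /(mE _ _ _ _ (in_deg_dinj x) (in_deg_dinj (y j))) ->.
  exact: eqxx.
exists j.
  by rewrite /=; apply: contraNneq vj => ->; rewrite dinj0 (addf0 (@varpiDr _)).
have -> : i = (i + j + m) - m - j by ring.
by rewrite ijm; ring.
Qed.

Definition gform y : gdual Q :=
  GDual (@varpiDl y) (fun c x => varpiZl c x y) (gform_fin y).

Lemma varpi_fe j k : varpi (f j) (e k) = (j == k)%:R.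
Proof. exact: hf.2. Qed.

Lemma e_coord y : finite_set [set j | varpi (f j) y != 0] /\
  y = \sum_(j \in [set: Omega]) varpi (f j) y *: e j.
Proof.
have [c [cf yE]] := he.1.2 y.
have cs : finsup (fun j => c j *: e j).
  by apply: (sub_finsup cf) => j /=; apply: contraNN => /eqP ->; rewrite scale0r.
have cE k : varpi (f k) y = c k.
  rewrite yE (addf_fsbigT (@varpiDr _) cs) (@fsbigT_single _ _ _ k).
    by rewrite varpiZr varpi_fe eqxx mulr1.
  by move=> j jk; rewrite varpiZr varpi_fe eq_sym (negbTE jk) mulr0.
split; first by apply: (sub_finite_set _ cf) => j; rewrite /= cE.
by rewrite {1}yE; apply: eq_fsbigT => j; rewrite cE.
Qed.

Lemma f_coord x : finite_set [set j | varpi x (e j) != 0] /\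
  x = \sum_(j \in [set: Omega]) varpi x (e j) *: f j.
Proof.
have [c [cf xE]] := hf.1.1.2 x.
have cs : finsup (fun j => c j *: f j).
  by apply: (sub_finsup cf) => j /=; apply: contraNN => /eqP ->; rewrite scale0r.
have cE k : varpi x (e k) = c k.
  rewrite xE (addf_fsbigT (@varpiDl _) cs) (@fsbigT_single _ _ _ k).
    by rewrite varpiZl varpi_fe eqxx mulr1.
  by move=> j jk; rewrite varpiZl varpi_fe (negbTE jk) mulr0.
split; first by apply: (sub_finite_set _ cf) => j; rewrite /= cE.
by rewrite {1}xE; apply: eq_fsbigT => j; rewrite cE.
Qed.

Lemma e_sum (W : zmodType) (h : L -> W) y : {morph h : x z / x + z} ->
  h y = \sum_(j \in [set: Omega]) h (varpi (f j) y *: e j).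
Proof.
move=> hD; rewrite {1}(e_coord y).2 (addf_fsbigT hD) //.
by apply: (sub_finsup (e_coord y).1) => j /=; apply: contraNN => /eqP ->; rewrite scale0r.
Qed.

Lemma f_sum (W : zmodType) (h : L -> W) x : {morph h : x z / x + z} ->
  h x = \sum_(j \in [set: Omega]) h (varpi x (e j) *: f j).
Proof.
move=> hD; rewrite {1}(f_coord x).2 (addf_fsbigT hD) //.
by apply: (sub_finsup (f_coord x).1) => j /=; apply: contraNN => /eqP ->; rewrite scale0r.
Qed.

Lemma f_dinj j p : f j p != 0 -> f j = dinj (f j p).
Proof.
have [i fi] := hf.1.2 j => fp; rewrite {1}(in_deg_eq fi).
by have [->//|pi] := eqVneq p i; move: fp; rewrite fi ?eqxx.
Qed.

(** If [f j] has degree p then, as it pairs to 1 with [e j], so does some [w i] pair nontrivially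
    with [e j]. There are finitely many [w i], each pairing nontrivially with finitely many
    [e j]. *)
Lemma f_fin p : finite_set [set j | f j p != 0].
Proof.
have [n [l [w wE]]] := Qfd p.
have fU : finite_set (\bigcup_(i in [set: 'I_n]) [set j | varpi (dinj (w i)) (e j) != 0]).
  by apply: bigcup_finite; [exact: finite_finset|move=> i _; exact: (f_coord _).1].
apply: (sub_finite_set _ fU) => j /= /f_dinj fj.
have : varpi (f j) (e j) != 0 by rewrite varpi_fe eqxx oner_neq0.
rewrite fj (wE (f j p)) (addf_sum (@dinjD _ _ p)) (addf_sum (@varpiDl _)).
move=> /sum_neq0[i _]; rewrite dinjZ varpiZl mulf_eq0 negb_or => /andP[_ vn].
by exists i.
Qed.

(** The terms of an explicit coproduct dual to the Leibniz product: up to sign, [vartheta] is the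
    sum of varpi(b, e_i o e_j) f_i (x) f_j. *)
Let tterm b (p : Omega * Omega) : ctens2 Q :=
  varpi b (circ (e p.1) (e p.2)) *: cot (f p.1) (f p.2).

Let tfin k : finite_set [set p : Omega * Omega | cot (f p.1) (f p.2) k != 0].
Proof.
apply: (sub_finite_set _ (finite_setX (f_fin k.1) (f_fin k.2))) => p /cot_neq0.
exact.
Qed.

Let tterm_fin b k : finsup (fun p => tterm b p k).
Proof.
apply: (sub_finsup (tfin k)) => p /=; apply: contraNN => /eqP tk.
rewrite -[X in X == 0]/(varpi b (circ (e p.1) (e p.2)) *: cot (f p.1) (f p.2) k).
by rewrite tk scaler0.
Qed.

Lemma is_vartheta_exists : exists theta, is_vartheta circ varpi theta.
Proof.
(* Pairing [f j] with y gives the coordinate of y along [e j], so pairing the sum with y and z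
   reassembles [varpi b (circ y z)]. *)
exists (fun b => - fsum (tterm b)); split.
  move=> c a b; apply: functional_extensionality_dep => k.
  rewrite -[LHS]/(- fsum (tterm (c *: a + b)) k).
  rewrite -[RHS]/(c *: - fsum (tterm a) k + - fsum (tterm b) k).
  rewrite /fsum scalerN -opprD; congr (- _).
  have ca : finsup (fun p => c *: tterm a p k).
    apply: (sub_finsup (tterm_fin a k)) => p /=; apply: contraNN => /eqP ->.
    by rewrite scaler0.
  rewrite (addf_fsbigT (@scalerDr _ _ c)) // -fsbigTD //.
  apply: eq_fsbigT => p.
  rewrite -[LHS]/(varpi (c *: a + b) (circ (e p.1) (e p.2)) *: cot (f p.1) (f p.2) k).
  by rewrite varpiDl varpiZl scalerDl -scalerA.
move=> b y z; rewrite -[LHS]/(test2 (gform y) (gform z) (- fsum (tterm b))).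
rewrite test2N; congr (- _).
rewrite /test2 csum_fsum; [|exact: form2_finform|by move=> k; exact: tterm_fin].
have tE p : csum (form2 (gform y) (gform z)) (tterm b p) =
    varpi b (circ (e p.1) (e p.2)) * (varpi (f p.1) y * varpi (f p.2) z).
  by rewrite [LHS]test2Z test2_cot.
rewrite (eq_fsbigT tE) fsbigT_pair; last first.
  apply: (sub_finsup (finite_setX (e_coord y).1 (e_coord z).1)) => p.
  by rewrite !mulf_eq0 !negb_or => /andP[_ /andP[]].
rewrite (@e_sum _ (fun u => varpi b (circ u z))); last first.
  by move=> u u'; rewrite (bilinDl cb) varpiDr.
apply: eq_fsbigT => i; rewrite (bilinZl _ _ _ cb) varpiZr.
rewrite (@e_sum _ (fun u => varpi (f i) y * varpi b (circ (e i) u))); last first.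
  by move=> u u'; rewrite (bilinDr cb) varpiDr mulrDr.
by apply: eq_fsbigT => j; rewrite (bilinZr cb) varpiZr /=; ring.
Qed.

Lemma varthetaP : is_vartheta circ varpi (vartheta circ varpi).
Proof. exact: xgetPex is_vartheta_exists. Qed.

Let gt_bilin (xi : dual P) y : bilin (fun a z => xi a * varpi z y : K^o).
Proof.
split=> [z|a] c u v; first by rewrite dualD dualZ mulrDl -mulrA.
by rewrite varpiDl varpiZl mulrDr mulrCA.
Qed.

Lemma gtest_sig (xi : dual P) y :
  {F : gdual (PQ_comp P Q) | forall a z, F (PQ_pure a z) = xi a * varpi z y}.
Proof.
pose g : PQ -> K := PQ_lift (fun a z => xi a * varpi z y : K^o).
have gl : linear (g : PQ -> K^o) := PQ_lift_linear (gt_bilin xi y).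
have gD : {morph g : X Y / X + Y} := linfD gl.
have gp a z : g (PQ_pure a z) = xi a * varpi z y := PQ_lift_pure a z (gt_bilin xi y).
have gF : finite_set [set i | exists t : PQ_comp P Q i, g (dinj t) != 0].
  apply: (sub_finite_set _ (gform_fin y)) => i [t].
  rewrite dinj_PQ_span (addf_sum gD) => /sum_neq0[p _].
  rewrite gp mulf_eq0 negb_or => /andP[_ vn].
  by exists p.2.
by exists (GDual gD (fun c X => linfZ c X gl) gF).
Qed.

Definition gtest xi y := sval (gtest_sig xi y).

Lemma gtest_pure xi y a z : gtest xi y (PQ_pure a z) = xi a * varpi z y.
Proof. exact: svalP (gtest_sig xi y) a z. Qed.

Definition is_gtest (F : gdual (PQ_comp P Q)) := exists xi y, F = gtest xi y.

(** Since [f j] has degree p and pairs to 1 with [e j], the degree of [e j] is - m - p, which pairs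
    with degree p only. *)
Lemma e_deg j p : f j p != 0 -> forall i (x : Q i), i != p -> varpi (dinj x) (e j) = 0.
Proof.
move=> fj i x ip; have [m mE] := form_graded hQ.
have [d de] := he.2 j.
have dp : p + d + m = 0.
  apply/eqP; apply: contraT => /(mE _ _ (f j) (e j)) v0.
  have /eqP := varpi_fe j j; rewrite v0 ?eqxx 1?eq_sym ?oner_eq0 //.
  by rewrite (f_dinj fj); exact: in_deg_dinj.
apply: (mE _ _ _ _ (in_deg_dinj x) de); apply: contraNneq ip => id0.
by apply/eqP; apply: (addIr d); apply: (addIr m); rewrite id0 dp.
Qed.

(** The dual basis consists of the functionals built from [l i] and [e j], with vectors
    [w i (x) f j], for the j such that [f j] has degree p. *)
Lemma gtest_frame p : frame is_gtest p.
Proof.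
have [n [l [w wE]]] := Pfd.
(* [A] lists the finitely many j with [f j] of degree p; the pairs (i, j) are then numbered by
   [enum_val], a frame being indexed by one ordinal. *)
have [A AE] := finite_fsetP.1 (f_fin p).
pose s : seq Omega := A.
pose ix (i : 'I_n * 'I_(size s)) := (i.1, tnth (in_tuple s) i.2).
pose N := #|{: 'I_n * 'I_(size s)}|.
pose J (k : 'I_N) := ix (enum_val k).
exists N, (fun k => gtest (l (J k).1) (e (J k).2)),
  (fun k => (w (J k).1 : P) \ot f (J k).2 p); split.
- by move=> k; exists (l (J k).1), (e (J k).2).
- move=> k i t ip; rewrite dinj_PQ_span (addf_sum (@gdD _ _ _)) big1 // => q _.
  rewrite gtest_pure (@e_deg _ p) ?mulr0 //.
  have : (J k).2 \in s by exact: mem_tnth.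
  by move=> js; have : [set` A] (J k).2 by []; rewrite -AE.
- move=> t; have tD : {morph (fun t : PQ_comp P Q p => \sum_(k < N)
      gtest (l (J k).1) (e (J k).2) (dinj t)
      *: ((w (J k).1 : P) \ot f (J k).2 p : PQ_comp P Q p)) : x y / x + y}.
    move=> x y; rewrite -big_split /=; apply: eq_bigr => k _.
    by rewrite dinjD gdD scalerDl.
  rewrite [LHS](tensor_span (t : tensor P (Q p))) tliftE.
  rewrite [in RHS](tensor_span (t : tensor P (Q p))) tliftE.
  rewrite [RHS](addf_sum tD); apply: eq_bigr => q _.
  (* Outside [s] the vectors [f j] have no component in degree p, so the expansion of [q.2] in the
     basis f is a sum over [s]. *)
  have zE : q.2 = \sum_(j < size s)
      varpi (dinj q.2) (e (tnth (in_tuple s) j)) *: f (tnth (in_tuple s) j) p.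
    rewrite -(big_tnth _ _ s xpredT (fun j => varpi (dinj q.2) (e j) *: f j p)).
    rewrite -{1}(dinj_in q.2) (@f_sum _ (fun u : L => u p)) //.
    apply: fsbigTE => j jA; suff f0 : f j p = 0.
      by rewrite -[LHS]/(_ *: f j p) f0 scaler0.
    apply/eqP; apply: contraNT jA => fj.
    by have : [set` A] j by rewrite -AE.
  rewrite {1}(wE q.1) {1}zE ot_sum pair_big /=.
  rewrite (reindex _ (onW_bij _ (@enum_val_bij _))) /=.
  by apply: eq_bigr => k _; rewrite dinj_ot gtest_pure.
Qed.

End Quadratic.

Lemma sub_frame (K : fieldType) (V : int -> lmodType K) (G G' : gdual V -> Prop) p :
  (forall F, G F -> G' F) -> frame G p -> frame G' p.
Proof.
by move=> GG [n [l [w [Gl l0 wE]]]]; exists n, l, w; split=> // i; exact: GG (Gl i).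
Qed.

Lemma gdual_sep (K : fieldType) (V : int -> lmodType K) (G : gdual V -> Prop) X Y :
  (forall p, frame G p) -> (forall F, G F -> F X = F Y) -> X = Y.
Proof.
move=> fr XY; apply: val_inj; apply: functional_extensionality_dep => p.
have [n [l [w [Gl l0 wE]]]] := fr p.
have E i (Z : dsum V) : l i (dinj (Z p)) = l i Z.
  by rewrite [RHS]gd_sum (@fsbigT_single _ _ _ p) // => j; exact: l0.
rewrite -[LHS]/(X p) -[RHS]/(Y p) (wE (X p)) (wE (Y p)).
by apply: eq_bigr => i _; rewrite !E XY.
Qed.

(** * Invariance and the ZD-YBE in terms of contractions *)

Section Affine.
Variables (K : fieldType) (P : lmodType K) (rhd lhd : P -> P -> P).
Hypothesis hP : Zinbiel_dendriform rhd lhd.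
Let rb := rhd_bilin hP.
Let lb := lhd_bilin hP.

Section TensorElement.
Variables (n : nat) (u v : 'I_n -> P) (r : tensor P P).
Hypothesis hr : r = \sum_i u i \ot v i.

(* r regarded as a map from the dual of P to P through its first, resp. second,
   tensor factor. *)
Definition contr (xi : dual P) : P := \sum_i xi (u i) *: v i.
Definition contr' (xi : dual P) : P := \sum_i xi (v i) *: u i.

Lemma linear_ominus m : linear (ominus rhd lhd m).
Proof.
by move=> c x y; rewrite /ominus rb.2 lb.1 scalerDr addrACA.
Qed.

Lemma bilin_ast : bilin (ast rhd lhd).
Proof.
split=> [v0|u0] c x y; rewrite /ast.
  by rewrite rb.1 lb.1 scalerDr addrACA.
by rewrite rb.2 lb.2 scalerDr addrACA.
Qed.

Lemma bilin_ominus : bilin (ominus rhd lhd).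
Proof.
split=> [v0|u0] c x y; last exact: linear_ominus.
by rewrite /ominus rb.1 lb.2 scalerDr addrACA.
Qed.

Lemma linear_ast_sym m : linear (fun x => ast rhd lhd m x + ast rhd lhd x m).
Proof.
by move=> c x y; rewrite bilin_ast.1 bilin_ast.2 addrACA -scalerDr.
Qed.

Lemma tmapD (f g : P -> P) : linear f -> linear g ->
  {morph tmap f g : s t / s + t}.
Proof.
by move=> fl gl; apply: tlift_bilinD; exact: bilin_comp (bilin_ot _ _) fl gl.
Qed.

Lemma tflipD : {morph @tflip K P P : s t / s + t}.
Proof.
apply: tlift_bilinD; split=> [y|x] c a b; first exact: (bilin_ot _ _).2.
exact: (bilin_ot _ _).1.
Qed.

Lemma tflip_ot (a b : P) : tflip (a \ot b) = b \ot a.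
Proof.
apply: tlift_ot; split=> [y|x] c x1 y1; first exact: (bilin_ot _ _).2.
exact: (bilin_ot _ _).1.
Qed.

Lemma tmap_ot (f g : P -> P) a b : linear f -> linear g ->
  tmap f g (a \ot b) = f a \ot g b.
Proof.
by move=> fl gl; apply: tlift_ot; exact: bilin_comp (bilin_ot _ _) fl gl.
Qed.

Lemma dual_lin (xi : dual P) (f : P -> P) (c : 'I_n -> K) (x : 'I_n -> P) : linear f ->
  xi (f (\sum_i c i *: x i)) = \sum_i c i * xi (f (x i)).
Proof.
move=> fl; rewrite (addf_sum (linfD fl)) dual_sum.
by apply: eq_bigr => i _; rewrite linfZ // dualZ.
Qed.

Lemma dual2_tmapr xi eta (g : P -> P) : linear g ->
  dual2 xi eta (tmap id g r) = eta (g (contr xi)).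
Proof.
move=> gl; rewrite hr (addf_sum (tmapD (@linear_idfun _ P) gl)) dual_sum dual_lin //.
by apply: eq_bigr => i _; rewrite tmap_ot // dual2_ot.
Qed.

Lemma dual2_tmapl xi eta (f : P -> P) : linear f ->
  dual2 xi eta (tmap f id r) = xi (f (contr' eta)).
Proof.
move=> fl; rewrite hr (addf_sum (tmapD fl (@linear_idfun _ P))) dual_sum dual_lin //.
by apply: eq_bigr => i _; rewrite tmap_ot // dual2_ot mulrC.
Qed.

Lemma dual2_tmapr_flip xi eta (g : P -> P) : linear g ->
  dual2 xi eta (tmap id g (tflip r)) = eta (g (contr' xi)).
Proof.
move=> gl; rewrite hr (addf_sum tflipD) (addf_sum (tmapD (@linear_idfun _ P) gl)).
rewrite dual_sum dual_lin //.
by apply: eq_bigr => i _; rewrite tflip_ot tmap_ot // dual2_ot.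
Qed.

Lemma dual2_tmapl_flip xi eta (f : P -> P) : linear f ->
  dual2 xi eta (tmap f id (tflip r)) = xi (f (contr eta)).
Proof.
move=> fl; rewrite hr (addf_sum tflipD) (addf_sum (tmapD fl (@linear_idfun _ P))).
rewrite dual_sum dual_lin //.
by apply: eq_bigr => i _; rewrite tflip_ot tmap_ot // dual2_ot mulrC.
Qed.

Lemma dual2_beta_lhd xi eta m : dual2 xi eta (beta_lhd rhd lhd r m) =
  eta (ominus rhd lhd m (contr xi)) - xi (ast rhd lhd m (contr' eta)).
Proof.
rewrite /beta_lhd (@dualD _ _ (dual2 xi eta)) (@dualN _ _ (dual2 xi eta)).
rewrite dual2_tmapr ?dual2_tmapl //.
  exact: bilin_ast.2.
exact: linear_ominus.
Qed.

Lemma dual2_beta_rhd xi eta m : dual2 xi eta (beta_rhd rhd lhd r m) =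
  xi (rhd m (contr' eta))
  - eta (ast rhd lhd m (contr xi) + ast rhd lhd (contr xi) m).
Proof.
rewrite /beta_rhd (@dualD _ _ (dual2 xi eta)) (@dualN _ _ (dual2 xi eta)).
rewrite dual2_tmapl ?dual2_tmapr //.
  exact: linear_ast_sym.
exact: rb.2.
Qed.

Hypothesis hinv : invariant_tensor rhd lhd (r + tflip r).

(** On contractions, adding tau r to r replaces each of [contr] and [contr'] by their sum. *)
Lemma inv_lhd (xi eta : dual P) m :
  eta (ominus rhd lhd m (contr xi)) + eta (ominus rhd lhd m (contr' xi))
  = xi (ast rhd lhd m (contr' eta)) + xi (ast rhd lhd m (contr eta)).
Proof.
have := congr1 (dual2 xi eta) (hinv m).1.
rewrite /beta_lhd (addf0 (@dualD _ _ _)).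
rewrite (@dualD _ _ (dual2 xi eta)) (@dualN _ _ (dual2 xi eta)).
rewrite (tmapD (@linear_idfun _ P) (linear_ominus m)).
rewrite (tmapD (bilin_ast.2 m) (@linear_idfun _ P)) !(@dualD _ _ (dual2 xi eta)).
rewrite dual2_tmapr ?dual2_tmapr_flip ?dual2_tmapl ?dual2_tmapl_flip;
  try solve [exact: bilin_ast.2|exact: linear_ominus].
by move/eqP; rewrite subr_eq0 => /eqP.
Qed.

Lemma inv_rhd (xi eta : dual P) m :
  xi (rhd m (contr' eta)) + xi (rhd m (contr eta)) =
  eta (ast rhd lhd m (contr xi) + ast rhd lhd (contr xi) m)
  + eta (ast rhd lhd m (contr' xi) + ast rhd lhd (contr' xi) m).
Proof.
have := congr1 (dual2 xi eta) (hinv m).2.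
rewrite /beta_rhd (addf0 (@dualD _ _ _)).
rewrite (@dualD _ _ (dual2 xi eta)) (@dualN _ _ (dual2 xi eta)).
rewrite (tmapD (@linear_idfun _ P) (linear_ast_sym m)).
rewrite (tmapD (rb.2 m) (@linear_idfun _ P)) !(@dualD _ _ (dual2 xi eta)).
rewrite dual2_tmapr ?dual2_tmapr_flip ?dual2_tmapl ?dual2_tmapl_flip;
  try solve [exact: rb.2|exact: linear_ast_sym].
by move/eqP; rewrite subr_eq0 !dualD => /eqP.
Qed.

(** The two invariance conditions combined so that the left multiplications [rhd m] cancel. In the
    S-equation this relates the ZD-YBE terms with xi and eta exchanged. *)
Lemma inv_lhd_sym (xi eta : dual P) m :
  xi (rhd (contr eta) m) + xi (rhd (contr' eta) m)
  + (xi (lhd m (contr eta)) + xi (lhd m (contr' eta)))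
  + (eta (lhd m (contr xi)) + eta (lhd m (contr' xi))) = 0.
Proof.
have i1 := inv_lhd eta xi m; have i2 := inv_rhd eta xi m.
move: i1 i2; rewrite /ominus /ast !dualD => i1 i2.
by lincomb (-1) i1; lincomb (-1) i2; ring.
Qed.

Hypothesis hYBE : ZD_YBE rhd lhd u v.

Lemma dual_bilin_sum (xi : dual P) (h : P -> P -> P) (a b : 'I_n -> K)
    (x y : 'I_n -> P) : bilin h ->
  xi (h (\sum_i a i *: x i) (\sum_j b j *: y j)) =
  \sum_i \sum_j a i * b j * xi (h (x i) (y j)).
Proof.
move=> hh; rewrite (addf_sum (bilinDl hh _)) dual_sum; apply: eq_bigr => i _.
rewrite (addf_sum (bilinDr hh _)) dual_sum; apply: eq_bigr => j _.
by rewrite (bilinZl _ _ _ hh) (bilinZr hh) !dualZ mulrA.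
Qed.

Lemma YBE_dual (xi eta zeta : dual P) :
  eta (ominus rhd lhd (contr xi) (contr' zeta))
  - zeta (ast rhd lhd (contr xi) (contr eta))
  + xi (lhd (contr' zeta) (contr' eta)) = 0.
Proof.
rewrite -(addf0 (@dualD _ _ (dual2 xi (dual2 eta zeta)))) -[X in dual2 _ _ X]hYBE.
rewrite dual_sum !dual_bilin_sum; [|exact: lb|exact: bilin_ast|exact: bilin_ominus].
rewrite -sumrN -!big_split /=; apply: eq_bigr => i _.
rewrite dual_sum -sumrN -!big_split /=; apply: eq_bigr => j _.
rewrite !dualD dualN !dual2_ot /ominus /ast !dualD.
by ring.
Qed.

End TensorElement.

End Affine.

(** * The pre-Lie bialgebra on P (x) Q *)

Section Main.
Variables (K : fieldType) (P : lmodType K) (rhd lhd : P -> P -> P).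
Hypothesis hP : Zinbiel_dendriform rhd lhd.
Variable Q : int -> lmodType K.
Variables (circ : dsum Q -> dsum Q -> dsum Q) (varpi : dsum Q -> dsum Q -> K).
Hypothesis hQ : quadratic_graded_Leibniz circ varpi.
Variables (Omega : choiceType) (e f : Omega -> dsum Q).
Hypotheses (he : homogeneous_basis e) (hf : homogeneous_dual_basis varpi e f).
Hypotheses (Pfd : fdim P) (Qfd : forall p, fdim (Q p)).
Local Notation mul := (PQ_mul rhd lhd circ).
Local Notation PQ := (dsum (PQ_comp P Q)).
Local Notation gt := (gtest hQ).
Let rb := rhd_bilin hP.
Let lb := lhd_bilin hP.
Let cb := Leibniz_bilin hQ.

Let fr := gtest_frame hQ he hf Pfd Qfd.
Let frT p := sub_frame (fun _ _ => I) (fr p).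

Let mulb : bilin mul := PQ_mul_bilin rb lb cb.
Let mulg : graded_mul mul := PQ_mul_graded rb lb cb (Leibniz_graded hQ).
Let mulE := PQ_mul_pure rb lb cb.
Let mulNl X Y : mul (- X) Y = - mul X Y. Proof. exact: addfN (bilinDl mulb Y) X. Qed.
Let mulNr X Y : mul X (- Y) = - mul X Y. Proof. exact: addfN (bilinDr mulb X) Y. Qed.

Let Leib x y z : circ (circ x y) z = circ x (circ y z) - circ y (circ x z).
Proof. by rewrite (Leibniz_identity hQ) addrK. Qed.

Lemma PQ_mul_preLie_pure a x b y c z :
  let X := PQ_pure a x in let Y := PQ_pure b y in let Z := PQ_pure c z in
  mul (mul X Y) Z - mul X (mul Y Z) = mul (mul Y X) Z - mul Y (mul X Z).
Proof.
move=> X Y Z; apply: (gdual_sep fr) => F [xi [t ->]].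
rewrite /X /Y /Z !mulE.
rewrite !(bilinDl mulb, bilinDr mulb, mulNl, mulNr) !mulE.
rewrite !(gdD, addfN (@gdD _ _ (gt xi t))) !gtest_pure !Leib.
rewrite !(varpiDl hQ, addfN (varpiDl hQ t)).
(* [Leib] has left only right-nested products in Q. On the P side [h1], [h2] and [h3] orient the
   Zinbiel-dendriform axioms into rewriting rules, [h3] solving the last axiom for the product of c
   with [rhd a1 b1]. *)
have h1 a1 b1 : xi (rhd a1 (rhd b1 c)) = xi (rhd (rhd a1 b1) c)
    + xi (rhd (lhd a1 b1) c) + (xi (rhd (rhd b1 a1) c) + xi (rhd (lhd b1 a1) c)).
  by rewrite (ZD_rhd_rhd hP) /ast !(bilinDl rb) !dualD.
have h2 a1 b1 : xi (rhd a1 (lhd c b1)) = xi (lhd (rhd a1 c) b1) + xi (lhd (lhd c a1) b1).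
  by rewrite (ZD_rhd_lhd hP) (ZD_lhd_ast hP) dualD.
have h3 a1 b1 : xi (lhd c (rhd a1 b1)) =
    xi (lhd (rhd a1 c) b1) + xi (lhd (lhd c a1) b1) - xi (lhd c (lhd a1 b1)).
  by rewrite -dualD -(ZD_lhd_ast hP) /ast (bilinDr lb) dualD addrK.
rewrite !h1 !h2 !h3.
by ring.
Qed.

Lemma PQ_mul_preLie X Y Z :
  mul (mul X Y) Z - mul X (mul Y Z) = mul (mul Y X) Z - mul Y (mul X Z).
Proof.
apply: (gdual_sep fr) => F _; pose A X Y Z : K := F (mul (mul X Y) Z)
  - F (mul X (mul Y Z)) - (F (mul (mul Y X) Z) - F (mul Y (mul X Z))).
have FB := addfB (@gdD _ _ F).
have A1 Y' Z' : {morph (fun X => A X Y' Z') : X X' / X + X'}.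
  by move=> X1 X2; rewrite /A !(bilinDl mulb, bilinDr mulb, gdD); ring.
have A2 X' Z' : {morph (fun Y => A X' Y Z') : Y Y' / Y + Y'}.
  by move=> X1 X2; rewrite /A !(bilinDl mulb, bilinDr mulb, gdD); ring.
have A3 X' Y' : {morph (fun Z => A X' Y' Z) : Z Z' / Z + Z'}.
  by move=> X1 X2; rewrite /A !(bilinDl mulb, bilinDr mulb, gdD); ring.
apply/eqP; rewrite -subr_eq0 !FB -/(A X Y Z); apply/eqP.
have [s ->] := PQ_span X; have [t ->] := PQ_span Y; have [w ->] := PQ_span Z.
rewrite (addf_sum (A1 _ _)) big1 // => p _.
rewrite (addf_sum (A2 _ _)) big1 // => q _.
rewrite (addf_sum (A3 _ _)) big1 // => o _.
by rewrite /A -!FB PQ_mul_preLie_pure subrr (addf0 (@gdD _ _ F)).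
Qed.

Variables (n : nat) (u v : 'I_n -> P) (r : tensor P P).
Hypothesis hr : r = \sum_i u i \ot v i.
Hypothesis hYBE : ZD_YBE rhd lhd u v.
Hypothesis hinv : invariant_tensor rhd lhd (r + tflip r).
Local Notation rh := (rhat u v e f).
Local Notation R := (contr u v).
Local Notation R' := (contr' u v).

Let rterm i j : ctens2 (PQ_comp P Q) := cot (PQ_pure (u i) (e j)) (PQ_pure (v i) (f j)).

Lemma PQ_pure_neq0 (a : P) (x : dsum Q) k : PQ_pure a x k != 0 -> x k != 0.
Proof.
by apply: contraNN => /eqP xk; rewrite -[X in X == 0]/(a \ot x k) xk ot0r.
Qed.

(** As [varpi (f j) (e j)] is 1, the degrees of [e j] and [f j] add up to - m, where m is the shift
    of the graded form. *)
Lemma rhat_homogeneous : exists d, homogeneous d rh.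
Proof.
have [m mE] := form_graded hQ; exists (- m) => k.
rewrite /rhat (addf_sum (f := fun S : ctens2 (PQ_comp P Q) => S k)) //.
move=> /sum_neq0[i _] fn.
have [j] : exists j, rterm i j k != 0.
  apply: contrapT => nj; move: fn; rewrite /fsum fsbigT0 ?eqxx // => j.
  by apply/eqP; apply: contra_notT nj => tn; exists j.
move=> /cot_neq0[/PQ_pure_neq0 en /PQ_pure_neq0 fn'].
have [d de] := he.2 j.
have -> : k.1 = d by apply/eqP; apply: contraNT en => /de ->.
have fE := f_dinj hf fn'.
suff : k.2 + d + m == 0 by move/eqP => km; rewrite -[- m]add0r -km; ring.
apply: contraT => /(mE _ _ (f j) (e j)) v0.
have := varpi_fe hf j j; rewrite v0 // ?eqxx; last by rewrite fE; exact: in_deg_dinj.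
by move/eqP; rewrite eq_sym oner_eq0.
Qed.

Lemma test2_rhat F H : test2 F H rh =
  \sum_i \sum_(j \in [set: Omega]) F (PQ_pure (u i) (e j)) * H (PQ_pure (v i) (f j)).
Proof.
rewrite /rhat (addf_sum (@test2D _ _ F H)); apply: eq_bigr => i _.
rewrite /test2 csum_fsum; last 2 first.
- exact: form2_finform.
- move=> k; apply: (sub_finite_set _ (f_fin hQ hf Qfd k.2)) => j.
  by move=> /cot_neq0[_ /PQ_pure_neq0].
by apply: eq_fsbigT => j; exact: test2_cot.
Qed.

Lemma test2_rhat_gtestr F eta y :
  test2 F (gt eta y) rh = F (PQ_pure (R' eta) y).
Proof.
rewrite test2_rhat /contr'.
rewrite (addf_sum (bilinDl (PQ_pure_bilin P Q) y)) (addf_sum (@gdD _ _ F)).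
apply: eq_bigr => i _; rewrite (bilinZl _ _ _ (PQ_pure_bilin P Q)) gdZ.
rewrite (e_sum hQ he hf (h := fun y => eta (v i) * F (PQ_pure (u i) y))); last first.
  by move=> y1 y2; rewrite (bilinDr (PQ_pure_bilin P Q)) gdD mulrDr.
apply: eq_fsbigT => j; rewrite gtest_pure (bilinZr (PQ_pure_bilin P Q)) gdZ.
by ring.
Qed.

(** The sign comes from skewness: x has coordinates [varpi x (e j)] along [f j], whereas the test
    functional produces [varpi (e j) x]. *)
Lemma test2_rhat_gtestl H xi x :
  test2 (gt xi x) H rh = H (- PQ_pure (R xi) x).
Proof.
rewrite test2_rhat (addfN (@gdD _ _ H)) /contr.
rewrite (addf_sum (bilinDl (PQ_pure_bilin P Q) x)) (addf_sum (@gdD _ _ H)).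
rewrite -sumrN; apply: eq_bigr => i _; rewrite (bilinZl _ _ _ (PQ_pure_bilin P Q)) gdZ.
rewrite (f_sum hQ hf (h := fun y => - (xi (u i) * H (PQ_pure (v i) y)))); last first.
  by move=> y1 y2; rewrite (bilinDr (PQ_pure_bilin P Q)) gdD mulrDr opprD.
apply: eq_fsbigT => j; rewrite gtest_pure (bilinZr (PQ_pure_bilin P Q)) gdZ.
by rewrite (form_skew hQ (e j)); ring.
Qed.

Lemma rho'_gtest d eta y : homogeneous d rh -> rho' rh (gt eta y) = PQ_pure (R' eta) y.
Proof.
move=> hd; apply: (gdual_sep frT) => F _.
by rewrite (rho'E hd) test2_rhat_gtestr.
Qed.

Lemma rho_gtest d xi x : homogeneous d rh -> rho rh (gt xi x) = - PQ_pure (R xi) x.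
Proof.
move=> hd; apply: (gdual_sep frT) => F _.
by rewrite (rhoE hd) test2_rhat_gtestl.
Qed.

Let cyc x y z := varpi_cycle hQ x y z.

Lemma rhat_S_equation : S_equation mul rh.
Proof.
have [d hd] := rhat_homogeneous.
split; first exact: (S_term_summable mulb hd).
apply: (test3_sep fr) => F H T [xi [x ->]] [eta [y ->]] [zeta [z ->]].
rewrite (test3_S_term mulb mulg hd) !(rho'_gtest _ _ hd) !(rho_gtest _ _ hd).
rewrite !(mulNl, mulNr) !opprK !mulE !(gdD, addfN (@gdD _ _ _)) !gtest_pure.
rewrite (varpi_swap hQ y z x) (varpi_swap hQ x z y) (varpi_swap hQ z y x).
rewrite (cyc x y z).
have Y1 := YBE_dual hP hYBE xi eta zeta; have Y2 := YBE_dual hP hYBE eta xi zeta.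
have i1 := inv_lhd_sym hP hr hinv xi eta (R' zeta).
move: Y1 Y2; rewrite /ominus /ast !dualD => Y1 Y2.
(* After [cyc] two scalars remain. The coefficient of [varpi (circ x y) z] is the ZD-YBE at (xi,
   eta, zeta); that of [varpi (circ y x) z] is minus the ZD-YBE at (eta, xi, zeta), up to the
   invariance relation at [R' zeta]. *)
lincomb (varpi (circ x y) z) Y1.
lincomb (varpi (circ y x) z) i1; lincomb (- varpi (circ y x) z) Y2.
by ring.
Qed.

(** On test functionals [rho] acts by - [R] and [rho'] by [R'], so the skew part of [rhat] contracts
    to [R] + [R'] up to sign. The two remaining values of varpi then carry combinations of the two
    invariance conditions of r + tau r. *)
Lemma rhat_invariant X : preLie_act mul X (rh - cflip rh) = 0.
Proof.
have [d hd] := rhat_homogeneous.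
apply: (test2_sep fr) => F H [xi [x ->]] [eta [y ->]].
pose phi X : K := gt xi x (mul X (PQ_pure (R' eta) y))
  + gt xi x (mul X (PQ_pure (R eta) y))
  - (gt eta y (mul X (PQ_pure (R xi) x)) - gt eta y (mul (PQ_pure (R xi) x) X))
  - (gt eta y (mul X (PQ_pure (R' xi) x)) - gt eta y (mul (PQ_pure (R' xi) x) X)).
have -> : test2 (gt xi x) (gt eta y) (preLie_act mul X (rh - cflip rh)) = phi X.
  rewrite (test2_preLie_act mulb mulg) !test2B !test2_cflip.
  rewrite -(rho'E hd _ (gt eta y)) -(rhoE hd (gt eta y)).
  rewrite -(rhoE hd (gt xi x)) -(rho'E hd _ (gt xi x)) !gcompE.
  rewrite !(rho'_gtest _ _ hd) !(rho_gtest _ _ hd) /phi.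
  by rewrite !(mulNl, mulNr, gdD, addfN (@gdD _ _ _)); ring.
have phiD : {morph phi : X Y / X + Y}.
  by move=> X1 X2; rewrite /phi !(bilinDl mulb, bilinDr mulb, gdD); ring.
have [s ->] := PQ_span X; rewrite (addf_sum phiD) big1 // => -[m w] _.
rewrite /phi /= !mulE !(gdD, addfN (@gdD _ _ _)) !gtest_pure.
rewrite (varpi_swap hQ w y x) (cyc w x y).
have i1 := inv_lhd hP hr hinv eta xi m; have i2 := inv_rhd hP hr hinv xi eta m.
move: i1 i2; rewrite /ominus /ast !dualD => i1 i2.
lincomb (varpi (circ w x) y + varpi (circ x w) y) i1.
lincomb (- varpi (circ x w) y) i2.
by ring.
Qed.

Lemma test2_bullet (xi eta : dual P) x y (s : tensor P P) (T : ctens2 Q) :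
  test2 (gt xi x) (gt eta y) (PQ_bullet s T) =
  dual2 xi eta s * hat_form varpi T x y.
Proof.
have E k : form2 (gt xi x) (gt eta y) (PQ_bullet s T k) =
    dual2 xi eta s * form2 (gform hQ x) (gform hQ y) (T k).
  rewrite dual2E /PQ_bullet /form2.
  rewrite (addf_tlift _ _ (tlift_bilinD (gdual_bilin (gt xi x) (gt eta y) _ _))).
  rewrite !(@tliftE _ _ _ K^o) mulr_suml; apply: eq_bigr => p _.
  rewrite (addf_tlift _ _ (tlift_bilinD (gdual_bilin (gt xi x) (gt eta y) _ _))).
  rewrite !(@tliftE _ _ _ K^o) mulr_sumr; apply: eq_bigr => q _.
  rewrite tlift_ot; last exact: gdual_bilin.
  by rewrite !dinj_ot !gtest_pure /=; ring.
rewrite /test2 /csum (eq_fsbigT E) (addf_fsbigT (f := fun a : K => _ * a)) //.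
  by move=> a b; rewrite mulrDr.
exact: (csum_finsup T (form2_finform (gform hQ x) (gform hQ y))).
Qed.

Lemma PQ_delta_coboundary : PQ_delta rhd lhd circ varpi r = coboundary mul rh.
Proof.
have [d hd] := rhat_homogeneous.
have [cl _] := coboundary_dfin mulb mulg hd frT.
have [_ th] := varthetaP hQ he hf Qfd.
apply/funext => X; rewrite /PQ_delta (PQ_lift_ext _ cl) // => a w.
apply/eqP; rewrite -subr_eq0; apply/eqP/(test2_sep fr) => F H [xi [x ->]] [eta [y ->]].
rewrite !test2B (test2_coboundary mulb mulg hd) !(rho'_gtest _ _ hd) !(rho_gtest _ _ hd).
rewrite !test2_bullet dual2_tflip (dual2_beta_rhd hP hr) (dual2_beta_lhd hP hr).
have -> : hat_form varpi (cflip (vartheta circ varpi w)) x y =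
    hat_form varpi (vartheta circ varpi w) y x.
  exact: (test2_cflip (gform hQ x) (gform hQ y)).
rewrite !th !(mulNl, mulNr) !mulE !(gdD, addfN (@gdD _ _ _)) !gtest_pure.
rewrite (form_skew hQ w (circ x y)) (form_skew hQ w (circ y x)).
rewrite (varpi_swap hQ x y w) (varpi_swap hQ y x w) (varpi_swap hQ w y x) (cyc w x y).
(* The part from [beta_rhd] matches the coboundary as it stands. The flipped part from [beta_lhd]
   has [R eta] and [R' xi] where the coboundary has [R' eta] and [R xi]; invariance exchanges them
   at the cost of a sign. *)
have := inv_lhd hP hr hinv eta xi a; rewrite /ominus /ast !dualD => i1.
lincomb (varpi (circ w x) y + varpi (circ x w) y) i1.
by ring.
Qed.

Theorem PQ_quasi_triangular :
  let delta := PQ_delta rhd lhd circ varpi r in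
  [/\ graded_mul mul, completed_preLie_bialgebra mul delta,
      delta = coboundary mul rh &
      completed_quasi_triangular mul (coboundary mul rh) rh].
Proof.
have [d hd] := rhat_homogeneous.
have qt := coboundary_quasi_triangular mulb mulg hd PQ_mul_preLie frT
  rhat_S_equation rhat_invariant.
move=> delta; rewrite /delta PQ_delta_coboundary.
by split; [exact: mulg|case: qt|by []|exact: qt].
Qed.

End Main.

Theorem theorem3p25 (K : fieldType)
    (P : vectType K) (rhd lhd : P -> P -> P)
    (hP : Zinbiel_dendriform rhd lhd)
    (Q : int -> vectType K)
    (circ : dsum (fun i => Q i) -> dsum (fun i => Q i) -> dsum (fun i => Q i))
    (varpi : dsum (fun i => Q i) -> dsum (fun i => Q i) -> K)
    (hQ : quadratic_graded_Leibniz circ varpi)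
    (n : nat) (u v : 'I_n -> P) (r : tensor P P)
    (hr : r = \sum_i u i \ot v i)
    (hYBE : ZD_YBE rhd lhd u v)
    (hinv : invariant_tensor rhd lhd (r + tflip r))
    (Omega : choiceType) (e f : Omega -> dsum (fun i => Q i))
    (he : homogeneous_basis e) (hf : homogeneous_dual_basis varpi e f) :
  let mul := PQ_mul rhd lhd circ in
  let delta := PQ_delta rhd lhd circ varpi r in
  [/\ graded_mul mul,
      completed_preLie_bialgebra mul delta,
      delta = coboundary mul (rhat u v e f) &
      completed_quasi_triangular mul (coboundary mul (rhat u v e f))
        (rhat u v e f)].
Proof.
exact: (PQ_quasi_triangular hP hQ he hf (vect_fdim P) (fun p => vect_fdim (Q p))
  hr hYBE hinv).
Qed.
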